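(* Let $T>0$ and let $g:[0,+\infty[\,\to\mathbb{R}$ be a $C^1$ function such that: (i) $g(0)=0$ and $g(u)>0$ for every $u>0$; (ii) there exists $R>0$ such that $g'(u)<0$ for every $u>R$, and $\lim_{u\to+\infty}g'(u)=0$; (iii) there exists $r>0$ such that $g'(u)>0$ for every $0<u<r$, and $\lim_{u\to0^+}g'(u)=0$. Let $a\in L^1(0,T)$ be sign-changing, i.e. $\int_0^T a^+(t)\,dt>0$ and $\int_0^T a^-(t)\,dt>0$, and suppose there exists $\tau\in[0,T]$ such that $a(t)\ge 0$ for a.e. $t\in[0,\tau]$ and $a(t)\le 0$ for a.e. $t\in[\tau,T]$. For $\lambda>0$ set $$\mu_0(\lambda)=\lambda\,\frac{\int_0^T a^+(t)\,dt}{\int_0^T a^-(t)\,dt}.$$ Consider, for $\lambda,\mu>0$, the Neumann problem $$u''+\big(\lambda a^+(t)-\mu a^-(t)\big)g(u)=0,\quad t\in[0,T],\qquad u'(0)=u'(T)=0. \qquad (P_{\lambda,\mu})$$ Then, for any $\lambda>0$ there exist $\mu_-(\lambda)\in\,]0,+\infty[$ and $\mu_+(\lambda)\in\,]0,+\infty]$, with $\mu_-(\lambda)<\mu_0(\lambda)<\mu_+(\lambda)$, such that problem $(P_{\lambda,\mu})$ has at least one positive solution for $\mu=\mu_0(\lambda)$ and at least two positive solutions for any $\mu\in\,]\mu_-(\lambda),\mu_+(\lambda)[$ different from $\mu_0(\lambda)$. Moreover, $\mu_+(\lambda)=+\infty$ for any $\lambda$ sufficiently large, that is, for $\lambda>\lambda^*$,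 with $\lambda^*>0$ depending only on $g$ and $a^+$.
   Context: Here $a^+=\max\{a,0\}$ and $a^-=\max\{-a,0\}$ denote the positive and negative parts of $a$, so $a=a^+-a^-$. Solutions are understood in the Carathéodory sense ($u\in C^1([0,T])$ with $u'$ absolutely continuous and the equation satisfied for a.e. $t\in[0,T]$). A solution $u$ is positive if $u(t)>0$ for every $t\in[0,T]$. The notation $]\alpha,\beta[$ denotes an open interval. *)

(* Defs.v *)
From HB Require Import structures.
From mathcomp Require Import all_boot all_order all_algebra.
From mathcomp Require Import all_classical all_reals all_analysis.

Set Implicit Arguments.
Unset Strict Implicit.
Unset Printing Implicit Defensive.

Import Order.TTheory GRing.Theory Num.Theory.
Import numFieldNormedType.Exports.

Local Open Scope classical_set_scope.
Local Open Scope ring_scope.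

(* The difference quotient is restricted to the domain D, so that the
   derivative is one-sided at an endpoint of an interval D and does not depend
   on the values of f outside D. *)
Definition has_derivative_within (R : realType) (D : set R) (f : R -> R)
    (x l : R) : Prop :=
  (f y - f x) / (y - x) @[y --> within D x^'] --> l.

(* f is of class C^1 on D, with derivative df; df is unique on D when D is a
   nondegenerate interval. *)
Definition C1_on (R : realType) (D : set R) (f df : R -> R) : Prop :=
  (forall x, D x -> has_derivative_within D f x (df x)) /\
  {within D, continuous df}.

Definition absolutely_continuous_on (R : realType) (a b : R) (f : R -> R) :
    Prop :=
  forall e : R, 0 < e -> exists2 d : R, 0 < d &
    forall (n : nat) (s t : 'I_n -> R),
      (forall i, a <= s i /\ s i <= t i /\ t i <= b) ->
      trivIset [set: 'I_n] (fun i => `]s i, t i[%classic) ->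
      \sum_(i < n) (t i - s i) < d ->
      \sum_(i < n) `|f (t i) - f (s i)| < e.

(* Caratheodory solution of u'' + q(t) g(u) = 0, u'(0) = u'(T) = 0. Only the
   values of u on [0, T] matter; they are required to lie in the domain
   [0, +oo[ of g. *)
Definition neumann_solution (R : realType) (T : R) (q g u : R -> R) : Prop :=
  (forall t : R, 0 <= t <= T -> 0 <= u t) /\
  exists du : R -> R,
    [/\ C1_on `[0, T] u du,
        absolutely_continuous_on 0 T du,
        {ae lebesgue_measure, forall t : R, 0 <= t <= T ->
           exists2 ddu : R, has_derivative_within `[0, T] du t ddu &
                            ddu + q t * g (u t) = 0},
        du 0 = 0 &
        du T = 0].

Definition positive_solution (R : realType) (T : R) (q g u : R -> R) : Prop :=
  neumann_solution T q g u /\ (forall t : R, 0 <= t <= T -> 0 < u t).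

Definition weight (R : realType) (a : R -> R) (lambda mu : R) : R -> R :=
  fun t => lambda * a^\+ t - mu * a^\- t.

Definition mu0 (R : realType) (T : R) (a : R -> R) (lambda : R) : R :=
  lambda * ((\int[lebesgue_measure]_(t in `[0, T]) a^\+ t) /
            (\int[lebesgue_measure]_(t in `[0, T]) a^\- t)).

Definition has_positive_solution (R : realType) (T : R) (a g : R -> R)
    (lambda mu : R) : Prop :=
  exists u, positive_solution T (weight a lambda mu) g u.

(* Distinct as functions on [0, T]. *)
Definition has_two_positive_solutions (R : realType) (T : R) (a g : R -> R)
    (lambda mu : R) : Prop :=
  exists u v,
    [/\ positive_solution T (weight a lambda mu) g u,
        positive_solution T (weight a lambda mu) g v &
        exists2 t : R, 0 <= t <= T & u t != v t].

(* Main.v *)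
Require Import Defs.
From HB Require Import structures.
From mathcomp Require Import all_boot all_order all_algebra.
From mathcomp Require Import all_classical all_reals all_analysis.
From mathcomp Require Import ring lra.

Set Implicit Arguments.
Unset Strict Implicit.
Unset Printing Implicit Defensive.

Import Order.TTheory GRing.Theory Num.Theory.
Import numFieldNormedType.Exports.

Local Open Scope classical_set_scope.
Local Open Scope ring_scope.

(** The proof is a shooting argument from the left end point.  Extended by zero
    to the negative reals, g is bounded and Lipschitz, so for every weight q in
    L^1 the Cauchy problem u'' + q g(u) = 0, u(0) = x, u'(0) = 0 has a global
    solution, depending continuously on x and on q
    ([cauchy_solution_exists], [cauchy_solution_dependence]).  Let F(x) be the
    value u'(T), with q = lambda a^+ - mu a^-.  A zero x > 0 of F is a positive
    solution of the Neumann problem: u is concave and then convex with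
    u'(0) = u'(T) = 0, so it is nonincreasing, and u(T) <= 0 is impossible since
    the constant u(T) would be a second solution with the same data at T
    ([neumann_data_positive], [cauchy_solution_end_pos]).
    Everything thus reduces to the sign changes of F on ]0, +oo[.

    These signs are read off from v = u'/g(u), which satisfies
    v' = - q - g'(u) v^2, so that
      F(x)/g(u(T)) = v(T) = - int_0^T q - int_0^T g'(u) v^2
    ([logarithmic_derivative]).  When x is very small or very large, u stays in
    a region where g' is small, v stays bounded and the last integral is small
    ([shooting_estimate]): if int q <> 0, then F has the sign of - int q near 0
    and near +oo ([shooting_small_mean], [shooting_large_mean]).  When int q = 0,
    that is when mu = mu_0(lambda), the last integral decides: as g' > 0 near 0
    and g' < 0 near +oo, F is negative for small x and positive for large x
    ([balanced_signs]).  This gives one zero of F between some x1 < x2.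

    The signs F(x1) < 0 < F(x2) persist for mu close to mu_0(lambda).  If
    mu > mu_0(lambda), then int q < 0 makes F positive for x close to 0, hence a
    second zero below x1; if mu < mu_0(lambda), then int q > 0 makes F negative
    for x large, hence a second zero above x2 ([two_neumann_data_near]).

    Finally, if lambda is large, the solution with u(0) = 1 becomes negative
    before the mass of a^+ is exhausted, hence whatever mu is; from there on it
    is affine and decreasing, so F(1) < 0 for all mu ([hitting_threshold]).  For
    mu > mu_0(lambda) the value F is positive both near 0 and near +oo, so there
    are two zeros around 1 without any upper bound on mu.

    As q is only integrable, u' is merely absolutely continuous.  The product
    and chain rules for primitives of L^1 functions, on which the identity for v
    and Gronwall's inequality rest, are both derived from a local-to-global
    principle, [integ_of_local]. *)

(** * Integrals over compact intervals *)
Section Integrals.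
Context {R : realType}.
Notation mu := (@lebesgue_measure R).
Implicit Types (f g h k : R -> R) (a b c s t : R).

(** Functions on the whole line are used throughout, so that integrals with
    varying end points need no side condition on the domain. *)
Definition L1loc f := forall a b, mu.-integrable `[a, b] (EFin \o f).

(** Zero when [b < a]: the integral is not oriented. *)
Definition integ f a b : R := \int[mu]_(t in `[a, b]) f t.

Lemma cont_epsP f t : {for t, continuous f} <->
  forall e, 0 < e -> exists2 d, 0 < d & forall s, `|s - t| < d -> `|f s - f t| < e.
Proof.
split.
  move=> /cvgrPdistC_lt ft e e0.
  have [d /= d0 H] := ft e e0.
  by exists d => // s st; apply: H; rewrite /= distrC.
move=> H; apply/cvgrPdistC_lt => e e0.
have [d d0 Hd] := H e e0.
by exists d => //= s; rewrite /= distrC => /Hd.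
Qed.

Lemma eq_L1loc f g : f =1 g -> L1loc f -> L1loc g.
Proof. by move=> /funext ->. Qed.

Lemma L1loc_continuous f : continuous f -> L1loc f.
Proof.
move=> cf a b; apply: continuous_compact_integrable; first exact: segment_compact.
exact: continuous_subspaceT.
Qed.

Lemma L1locD f g : L1loc f -> L1loc g -> L1loc (fun t => f t + g t).
Proof.
move=> lf lg a b.
by have := @integrableD _ _ _ mu _ (measurable_itv _) _ _ (lf a b) (lg a b).
Qed.

Lemma L1locZ c f : L1loc f -> L1loc (fun t => c * f t).
Proof.
move=> lf a b.
by have := @integrableZl _ _ _ mu _ (measurable_itv _) c _ (lf a b).
Qed.

Lemma L1locN f : L1loc f -> L1loc (fun t => - f t).
Proof.
by move=> lf; apply: eq_L1loc (L1locZ (-1) lf) => t; rewrite mulN1r.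
Qed.

Lemma L1locB f g : L1loc f -> L1loc g -> L1loc (fun t => f t - g t).
Proof. by move=> lf lg; apply: L1locD => //; exact: L1locN. Qed.

Lemma L1loc_norm f : L1loc f -> L1loc (fun t => `|f t|).
Proof. by move=> lf a b; exact: integrable_norm. Qed.

Lemma L1locM f g : L1loc f -> continuous g -> L1loc (fun t => f t * g t).
Proof.
move=> lf cg a b.
have cg' : {within `[a, b], continuous g} by exact: continuous_subspaceT.
have := @integrableMl _ _ _ mu `[a, b] (measurable_itv _) (EFin \o f) g (lf a b).
apply.
  by apply: (@measurable_funS _ _ _ _ setT) => //; exact: measurable_realfun.continuous_measurable_fun.
have /compact_bounded[M [_ mrt]] := continuous_compact cg' (@segment_compact _ a b).
by exists M; split; rewrite ?num_real // => ? ? ? ?; exact: mrt.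
Qed.

Lemma L1locMl f g : continuous f -> L1loc g -> L1loc (fun t => f t * g t).
Proof. by move=> cf lg; apply: eq_L1loc (L1locM lg cf) => t; rewrite mulrC. Qed.

Lemma L1loc_cst c : L1loc (fun=> c).
Proof. by apply: L1loc_continuous => t; exact: cvg_cst. Qed.

Lemma integ_ge f a b : b < a -> integ f a b = 0.
Proof.
by move=> ab; rewrite /integ set_itv_ge ?Rintegral_set0// -leNgt bnd_simp.
Qed.

Lemma integ_id f a : integ f a a = 0.
Proof. by rewrite /integ set_itv1 Rintegral_set1. Qed.

Lemma integ_chasles f a b c : L1loc f -> a <= b -> b <= c ->
  integ f a c = integ f a b + integ f b c.
Proof.
move=> lf ab bc.
have := @Rintegral_itvB _ f (BLeft a) (BRight c) b (lf a c).
rewrite !bnd_simp => /(_ ab bc) E.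
rewrite /integ -(@Rintegral_itv_obnd_cbnd _ b).
  by rewrite -E addrCA subrr addr0.
by apply: (integrableS _ _ _ (lf b c)) => //; apply: subset_itvr; rewrite bnd_simp.
Qed.

Lemma integD f g a b : L1loc f -> L1loc g ->
  integ (fun t => f t + g t) a b = integ f a b + integ g a b.
Proof. by move=> lf lg; rewrite /integ RintegralD. Qed.

Lemma integB f g a b : L1loc f -> L1loc g ->
  integ (fun t => f t - g t) a b = integ f a b - integ g a b.
Proof. by move=> lf lg; rewrite /integ RintegralB. Qed.

Lemma integZ c f a b : L1loc f ->
  integ (fun t => c * f t) a b = c * integ f a b.
Proof. by move=> lf; rewrite /integ RintegralZl. Qed.

Lemma integN f a b : L1loc f -> integ (fun t => - f t) a b = - integ f a b.
Proof.
move=> lf; rewrite -[RHS]mulN1r -integZ//.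
by congr integ; apply/funext => t; rewrite mulN1r.
Qed.

Lemma integ_cst c a b : a <= b -> integ (fun=> c) a b = c * (b - a).
Proof.
move=> ab; rewrite /integ Rintegral_cst//= lebesgue_measure_itv/= lte_fin.
case: ifPn => //=; rewrite -leNgt => ba.
by rewrite (@le_anti _ _ a b) ?ab// subrr.
Qed.

Lemma eq_integ f g a b : (forall t, a <= t <= b -> f t = g t) ->
  integ f a b = integ g a b.
Proof.
by move=> fg; apply: eq_Rintegral => t; rewrite inE/= in_itv/= => /fg.
Qed.

Lemma le_integ f g a b : L1loc f -> L1loc g ->
  (forall t, a <= t <= b -> f t <= g t) -> integ f a b <= integ g a b.
Proof.
by move=> lf lg fg; apply: le_Rintegral => // t /=; rewrite in_itv/= => /fg.
Qed.

Lemma integ_ge0 f a b : (forall t, a <= t <= b -> 0 <= f t) -> 0 <= integ f a b.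
Proof.
by move=> f0; apply: Rintegral_ge0 => t /=; rewrite in_itv/= => /f0.
Qed.

Lemma normr_integ f a b : L1loc f ->
  `|integ f a b| <= integ (fun t => `|f t|) a b.
Proof. by move=> lf; apply: le_normr_Rintegral. Qed.

Lemma le_normr_integ f g a b : L1loc f -> L1loc g ->
  (forall t, a <= t <= b -> `|f t| <= g t) -> `|integ f a b| <= integ g a b.
Proof.
move=> lf lg fg; apply: le_trans (normr_integ _ _ lf) _.
by apply: le_integ => //; exact: L1loc_norm.
Qed.

Lemma le_integ_itv f a b c d : L1loc f -> (forall t, 0 <= f t) ->
  a <= b -> c <= d -> integ f b c <= integ f a d.
Proof.
move=> lf f0 ab cd; have [bc|cb] := leP b c; last first.
  by rewrite integ_ge// integ_ge0.
rewrite (integ_chasles lf ab (le_trans bc cd)) (integ_chasles lf bc cd).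
by rewrite addrCA lerDl addr_ge0// integ_ge0.
Qed.

Lemma integ_dist f a s t : L1loc f -> s <= t ->
  `|integ f a t - integ f a s| <= integ (fun r => `|f r|) s t.
Proof.
move=> lf st; have [as_|sa] := leP a s.
  by rewrite (integ_chasles lf as_ st) [X in X - _]addrC addrK normr_integ.
rewrite (integ_ge _ sa) subr0; apply: le_trans (normr_integ _ _ lf) _.
by apply: le_integ_itv => //; [exact: L1loc_norm|exact: ltW].
Qed.

Lemma integ_abs_cont f a b e : L1loc f -> 0 < e -> exists2 d, 0 < d &
  forall A : set R, measurable A -> A `<=` `[a, b] -> (mu A < d%:E)%E ->
    \int[mu]_(t in A) `|f t| < e.
Proof.
move=> lf e0.
have : mu.-integrable setT (EFin \o f \_ `[a, b]).
  by rewrite -restrict_EFin; apply/integrable_restrict => //=; rewrite setTI.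
move=> /integral_normr_continuous /(_ _ e0)[d [d0 /=]] H.
exists d => // A mA Aab Ad; apply: le_lt_trans (H A mA Ad).
rewrite le_eqVlt; apply/orP; left; apply/eqP.
rewrite /Rintegral; congr fine; apply: eq_integral => x /[!inE] Ax.
by rewrite patchE mem_set//; exact: Aab.
Qed.

Lemma integ_continuous f a : L1loc f -> continuous (integ f a).
Proof.
move=> lf t; apply/cont_epsP => e e0.
have [d d0 H] := integ_abs_cont (t - 1) (t + 1) lf e0.
(* The window of radius 1 makes the uniform absolute continuity applicable. *)
have key s s' : t - 1 <= s -> s' <= t + 1 -> s <= s' -> s' - s < d ->
    `|integ f a s' - integ f a s| < e.
  move=> h1 h2 h3 h4; apply: le_lt_trans (integ_dist _ lf h3) _.
  apply: H => //.
    by apply: subset_itv; rewrite bnd_simp.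
  rewrite lebesgue_measure_itv/= lte_fin; case: ifP => _; last by rewrite lte_fin.
  by rewrite -EFinD lte_fin.
exists (Num.min 1 d); first by rewrite lt_min ltr01.
move=> s; rewrite lt_min => /andP[s1 sd].
have [st|ts] := leP s t.
  rewrite distrC; apply: key => //; move: s1 sd; rewrite ler0_norm ?subr_le0//; lra.
apply: key => //; try (exact: ltW); move: s1 sd; rewrite gtr0_norm ?subr_gt0//; lra.
Qed.

End Integrals.

(** * Calculus for primitives of locally integrable functions *)
Section Calculus.
Context {R : realType}.
Notation mu := (@lebesgue_measure R).
Implicit Types (f g h k : R -> R) (a b c s t : R).

Lemma integ_has_derivative_within f a b t : continuous f -> a <= t <= b ->
  has_derivative_within `[a, b] (integ f a) t (f t).
Proof.
move=> cf /andP[at_ tb]; have lf := L1loc_continuous cf.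
apply/cvgrPdist_le => e e0.
have [d d0 Hd] := (cont_epsP f t).1 (cf t) e e0.
have bnd s s' : s < s' -> (forall r, s <= r <= s' -> `|f r - f t| <= e) ->
    `|integ f s s' - f t * (s' - s)| <= e * (s' - s).
  move=> ss' H; rewrite -!(integ_cst _ (ltW ss')) -integB//; last exact: L1loc_cst.
  apply: le_normr_integ => //; last exact: L1loc_cst.
  by apply: L1locB => //; exact: L1loc_cst.
exists d => //= y; rewrite /= => ty yt; rewrite in_itv/= => /andP[ay yb].
have [ty'|yt'|E] := ltgtP t y; last by rewrite E eqxx in yt.
- rewrite (integ_chasles lf at_ (ltW ty')) [X in X / _]addrC addKr.
  have yt0 : 0 < y - t by rewrite subr_gt0.
  rewrite -(@ler_pM2r _ (y - t))// -[X in _ * X <= _](gtr0_norm yt0) -normrM.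
  rewrite mulrBl divfK ?gt_eqF// distrC; apply: bnd => // r /andP[r1 r2].
  apply/ltW/Hd; rewrite ger0_norm ?subr_ge0//.
  by move: ty; rewrite distrC gtr0_norm//; lra.
- rewrite (integ_chasles lf ay (ltW yt')) opprD addrA subrr add0r.
  have yt0 : 0 < t - y by rewrite subr_gt0.
  rewrite -(opprB t y) invrN mulrNN.
  rewrite -(@ler_pM2r _ (t - y))// -[X in _ * X <= _](gtr0_norm yt0) -normrM.
  rewrite mulrBl divfK ?gt_eqF// distrC; apply: bnd => // r /andP[r1 r2].
  apply/ltW/Hd; rewrite ler0_norm ?subr_le0// opprB.
  by move: ty; rewrite gtr0_norm//; lra.
Qed.

Lemma integ_open f a b : L1loc f -> \int[mu]_(t in `]a, b[) f t = integ f a b.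
Proof.
move=> lf; rewrite Rintegral_itv_bndo_bndc.
  rewrite Rintegral_itv_obnd_cbnd//.
  by apply: (integrableS _ _ _ (lf a b)) => //; apply: subset_itvr; rewrite bnd_simp.
by apply: (integrableS _ _ _ (lf a b)) => //; exact: subset_itvW.
Qed.

Lemma eq_integ_interior f g (a b : R) : L1loc f -> L1loc g ->
  (forall t, a < t < b -> f t = g t) -> integ f a b = integ g a b.
Proof.
move=> lf lg fg; rewrite -!integ_open//; apply: eq_Rintegral => t.
by rewrite inE/= in_itv/= => /fg.
Qed.

Lemma integ_absolutely_continuous f a b : L1loc f ->
  absolutely_continuous_on a b (integ f a).
Proof.
move=> lf e e0; have [d d0 H] := integ_abs_cont a b lf e0.
exists d => // n s t st triv sd.
pose F (i : 'I_n) := `]s i, t i[%classic.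
pose D := \big[setU/set0]_(i < n) F i.
have mF i : measurable (F i) by exact: measurable_itv.
have mD : measurable D by apply: bigsetU_measurable => i _.
have Dab : D `<=` `[a, b].
  rewrite /D -bigcup_seq => r [i _]; rewrite /F/= !in_itv/= => /andP[r1 r2].
  have [h1 [h2 h3]] := st i.
  by rewrite (le_trans h1 (ltW r1)) (le_trans (ltW r2) h3).
have muD : (mu D < d%:E)%E.
  rewrite /D measure_semi_additive_ord//=.
  under eq_bigr => i _.
    rewrite (_ : mu (F i) = (t i - s i)%:E); first over.
    rewrite /F lebesgue_measure_itv/= lte_fin; case: ifPn => //.
    rewrite -leNgt => ts; have [_ [st' _]] := st i.
    by rewrite (@le_anti _ _ (t i) (s i)) ?ts// subrr.
  by rewrite sumEFin lte_fin.
apply: le_lt_trans (H D mD Dab muD).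
have iD : mu.-integrable D (EFin \o (fun r => `|f r|)).
  by apply: (integrableS _ _ _ (L1loc_norm lf a b)) => //; exact: mD.
have -> : \int[mu]_(r in D) `|f r| = \sum_(i < n) integ (fun r => `|f r|) (s i) (t i).
  rewrite /Rintegral /D integral_bigsetU_EFin//=.
  - rewrite -sum_fine//.
      apply: eq_bigr => i _; rewrite /integ.
      by apply: integ_open; exact: L1loc_norm.
    move=> i _; apply: integrable_fin_num; first exact: measurable_itv.
    rewrite /F; have := L1loc_norm lf (s i) (t i).
    by apply: integrableS => //; exact: subset_itvW.
  - exact: index_enum_uniq.
  - by apply: sub_trivIset triv.
  - exact: measurable_int iD.
apply: ler_sum => i _; apply: integ_dist => //.
by have [_ []] := st i.
Qed.

(** The common source of the product and chain rules.  An additive function of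
    intervals that is locally dominated by [e] times the measure [k dt], for
    every [e], is zero; the supremum of the points up to which the estimate with
    constant [e] holds is the right end point.  Working with [k dt] instead of
    the length is what makes the principle apply to merely integrable
    densities, whose primitives have no derivative at some points. *)
Lemma integ_of_local H h k a b : L1loc h -> L1loc k -> a <= b ->
  (forall t e, a <= t <= b -> 0 < e -> exists2 d, 0 < d &
     forall s s', a <= s -> s <= t -> t <= s' -> s' <= b ->
       `|s - t| < d -> `|s' - t| < d ->
       `|H s' - H s - integ h s s'| <= e * integ k s s') ->
  H b - H a = integ h a b.
Proof.
move=> lh lk ab loc.
suff key e : 0 < e -> `|H b - H a - integ h a b| <= e * integ k a b.
  apply/eqP; rewrite -subr_eq0 -normr_le0; apply/ler_addgt0Pr => e e0.
  rewrite add0r.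
  have c0 : 0 < `|integ k a b| + 1 by rewrite ltr_wpDl.
  apply: le_trans (key (e / (`|integ k a b| + 1)) _) _; first exact: divr_gt0.
  rewrite mulrAC ler_pdivrMr// ler_pM2l//.
  by apply: le_trans (ler_norm _) _; rewrite lerDl.
move=> e0.
pose S := [set t | a <= t <= b /\ `|H t - H a - integ h a t| <= e * integ k a t].
have Sa : S a by split; rewrite ?lexx// !integ_id subrr subr0 normr0 mulr0.
have Sb t : S t -> t <= b by case=> /andP[].
have supS : has_sup S by split; [exists a|exists b => t /Sb].
have as_ : a <= sup S by apply: sup_upper_bound.
have sb : sup S <= b by apply: ge_sup => //; exists a.
have [d d0 Hd] := loc (sup S) e (introT andP (conj as_ sb)) e0.
have [t St td] := sup_adherent d0 supS.
have ts : t <= sup S by apply: sup_upper_bound.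
pose s' := Num.min b (sup S + d / 2).
have s's : sup S <= s' by rewrite le_min sb lerDl divr_ge0// ltW.
have s'b : s' <= b by rewrite ge_min lexx.
have Ss' : S s'.
  have [/andP[at_ tb] Ht] := St.
  split; first by rewrite s'b andbT (le_trans as_).
  have h1 : `|t - sup S| < d by rewrite ler0_norm ?subr_le0//; lra.
  have h2 : `|s' - sup S| < d.
    rewrite ger0_norm ?subr_ge0// ltrBlDl.
    by apply: (@le_lt_trans _ _ (sup S + d / 2)); [rewrite ge_min lexx orbT|lra].
  have := Hd t s' at_ ts s's s'b h1 h2.
  have ts' := le_trans ts s's.
  rewrite (integ_chasles lh at_ ts') (integ_chasles lk at_ ts') mulrDr => H1.
  have -> : H s' - H a - (integ h a t + integ h t s') =
    (H t - H a - integ h a t) + (H s' - H t - integ h t s') by ring.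
  by apply: le_trans (ler_normD _ _) (lerD _ _).
have : s' <= sup S by apply: sup_upper_bound.
rewrite ge_min => /orP[bs|]; last by move: d0; lra.
have <- : s' = b by apply/le_anti; rewrite s'b (le_trans bs).
by have [] := Ss'.
Qed.

(** On a short interval [s, s'] the increment of [F G] is
    [G(s') int f + F(s) int g], which differs from [int (f G + F g)] by the
    oscillation of [F] and [G] times [int (|f| + |g|)]. *)
Lemma product_rule (F G f g : R -> R) (c1 c2 a b : R) : L1loc f -> L1loc g -> a <= b ->
  (forall t, a <= t <= b -> F t = c1 + integ f a t) ->
  (forall t, a <= t <= b -> G t = c2 + integ g a t) ->
  F b * G b - F a * G a = integ (fun t => f t * G t + F t * g t) a b.
Proof.
move=> lf lg ab EF EG.
have aa : a <= a <= b by rewrite lexx.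
have bb : a <= b <= b by rewrite lexx ab.
rewrite (@eq_integ _ _ (fun t => f t * (c2 + integ g a t) + (c1 + integ f a t) * g t)); last first.
  by move=> t tab; rewrite EF// EG.
rewrite !(EF a, EF b, EG a, EG b)//.
have cF : continuous (fun t => c1 + integ f a t).
  by move=> t; apply: cvgD; [exact: cvg_cst|exact: integ_continuous].
have cG : continuous (fun t => c2 + integ g a t).
  by move=> t; apply: cvgD; [exact: cvg_cst|exact: integ_continuous].
have lh : L1loc (fun t => f t * (c2 + integ g a t) + (c1 + integ f a t) * g t).
  by apply: L1locD; [exact: L1locM|exact: L1locMl].
pose k t := `|f t| + `|g t|.
have lk : L1loc k by apply: L1locD; exact: L1loc_norm.
apply: (@integ_of_local (fun t => (c1 + integ f a t) * (c2 + integ g a t)) _ k) => //.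
move=> t e _ e0; have e20 : 0 < e / 2 by rewrite divr_gt0.
have [d1 d10 H1] := (cont_epsP _ _).1 (cF t) _ e20.
have [d2 d20 H2] := (cont_epsP _ _).1 (cG t) _ e20.
exists (Num.min d1 d2); first by rewrite lt_min d10.
move=> s s' as_ st ts' s'b; rewrite !lt_min => /andP[s1 s2] /andP[s'1 s'2].
have ss' := le_trans st ts'.
set Fs := c1 + integ f a s; set Gs' := c2 + integ g a s'.
have -> : (c1 + integ f a s') * Gs' - Fs * (c2 + integ g a s) =
    integ f s s' * Gs' + Fs * integ g s s'.
  rewrite /Fs /Gs' (integ_chasles lf as_ ss') (integ_chasles lg as_ ss'); ring.
have -> : integ f s s' * Gs' + Fs * integ g s s' =
    integ (fun r => Gs' * f r + Fs * g r) s s'.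
  by rewrite integD ?integZ//; [rewrite mulrC|exact: L1locZ..].
rewrite -integB//; last by apply: L1locD; exact: L1locZ.
rewrite -integZ//; apply: le_normr_integ.
- by apply: L1locB => //; apply: L1locD; exact: L1locZ.
- exact: L1locZ.
move=> r /andP[sr rs'].
have rt d : `|s - t| < d -> `|s' - t| < d -> `|r - t| < d.
  rewrite (ler0_norm (_ : s - t <= 0)) ?subr_le0// (ger0_norm (_ : 0 <= s' - t)) ?subr_ge0//.
  by move=> h1 h2; rewrite ltr_norml; apply/andP; split; lra.
have G1 : `|Gs' - (c2 + integ g a r)| <= e.
  rewrite -[X in X - _](subrK (c2 + integ g a t)) -addrA.
  apply: le_trans (ler_normD _ _) _; rewrite [e]splitr lerD// ltW//; first exact: H2.
  by rewrite distrC; apply: H2; exact: rt.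
have F1 : `|Fs - (c1 + integ f a r)| <= e.
  rewrite -[X in X - _](subrK (c1 + integ f a t)) -addrA.
  apply: le_trans (ler_normD _ _) _; rewrite [e]splitr lerD// ltW//; first exact: H1.
  by rewrite distrC; apply: H1; exact: rt.
have -> : Gs' * f r + Fs * g r - (f r * (c2 + integ g a r) + (c1 + integ f a r) * g r)
  = (Gs' - (c2 + integ g a r)) * f r + (Fs - (c1 + integ f a r)) * g r by ring.
rewrite /k mulrDr; apply: le_trans (ler_normD _ _) _; rewrite !normrM.
by apply: lerD; apply: ler_wpM2r.
Qed.

Lemma mean_value_ball (phi phi' : R -> R) (z d : R) :
  (forall x : R, `|x - z| < d -> is_derive x 1 phi (phi' x)) ->
  forall x y, `|x - z| < d -> `|y - z| < d ->
  exists2 w, `|w - z| < d & phi y - phi x = phi' w * (y - x).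
Proof.
move=> dphi.
have key x y : x <= y -> `|x - z| < d -> `|y - z| < d ->
    exists2 w, `|w - z| < d & phi y - phi x = phi' w * (y - x).
  move=> xy xz yz.
  have inb r : x <= r <= y -> `|r - z| < d.
    move: xz yz; rewrite !ltr_norml => /andP[x1 x2] /andP[y1 y2] /andP[r1 r2].
    by apply/andP; split; lra.
  have [||w wxy E] := @MVT_segment R phi phi' x y xy.
  - by move=> r rxy; apply: dphi; apply: inb; rewrite !ltW ?(itvP rxy).
  - apply: derivable_within_continuous => r rxy.
    by have [] := dphi r (inb _ rxy).
  - by exists w => //; apply: inb; rewrite !(itvP wxy).
move=> x y xz yz; have [xy|/ltW yx] := leP x y; first exact: key.
have [w wz E] := key y x yx yz xz; exists w => //.
by rewrite -(opprB (phi x)) E -mulrN opprB.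
Qed.

(** [phi] is only required to be of class C^1 near the values taken by the
    primitive, which allows [phi] to be singular elsewhere, like the inverse of
    a function vanishing at 0; [h] stands for the derivative on [[a, b]] and may
    be anything outside. *)
Lemma chain_rule (k h phi phi' : R -> R) c a b : L1loc k -> L1loc h -> a <= b ->
  (forall t, a <= t <= b -> exists2 d, 0 < d &
     forall z, `|z - (c + integ k a t)| < d -> is_derive z 1 phi (phi' z)) ->
  (forall t, a <= t <= b -> {for c + integ k a t, continuous phi'}) ->
  (forall t, a <= t <= b -> h t = phi' (c + integ k a t) * k t) ->
  phi (c + integ k a b) - phi c = integ h a b.
Proof.
move=> lk lh ab dphi cphi Eh.
have -> : phi c = phi (c + integ k a a) by rewrite integ_id addr0.
have cK : continuous (fun t => c + integ k a t).
  by move=> t; apply: cvgD; [exact: cvg_cst|exact: integ_continuous].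
have lk' := L1loc_norm lk.
apply: (@integ_of_local (fun t => phi (c + integ k a t)) _ (fun t => `|k t|)) => //.
move=> t e tab e0; have e20 : 0 < e / 2 by rewrite divr_gt0.
have [d1 d10 H1] := dphi t tab.
have [d2 d20 H2] := (cont_epsP _ _).1 (cphi t tab) _ e20.
pose d := Num.min d1 d2.
have d0 : 0 < d by rewrite lt_min d10.
have [d3 d30 H3] := (cont_epsP _ _).1 (cK t) _ d0.
exists d3 => // s s' as_ st ts' s'b sd s'd.
have ss' := le_trans st ts'.
have [|w wd ->] := @mean_value_ball phi phi' (c + integ k a t) d _ _ _ (H3 s sd) (H3 s' s'd).
  by move=> x; rewrite lt_min => /andP[+ _]; exact: H1.
rewrite [in X in _ * X](integ_chasles lk as_ ss').
have -> : c + (integ k a s + integ k s s') - (c + integ k a s) = integ k s s' by ring.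
rewrite -integZ// -integB//; last exact: L1locZ.
rewrite -integZ//; apply: le_normr_integ; [|exact: L1locZ|].
  by apply: L1locB => //; exact: L1locZ.
move=> r /andP[sr rs']; rewrite Eh; last by rewrite (le_trans as_ sr) (le_trans rs').
have rt : `|r - t| < d3.
  move: sd s'd.
  rewrite (ler0_norm (_ : s - t <= 0)) ?subr_le0// (ger0_norm (_ : 0 <= s' - t)) ?subr_ge0//.
  by move=> h1 h2; rewrite ltr_norml; apply/andP; split; lra.
rewrite -mulrBl normrM ler_wpM2r//.
rewrite -[X in X - _](subrK (phi' (c + integ k a t))) -addrA.
apply: le_trans (ler_normD _ _) _; rewrite [e]splitr lerD// ltW//.
  by apply: H2; move: wd; rewrite lt_min => /andP[].
by rewrite distrC; apply: H2; have := H3 _ rt; rewrite lt_min => /andP[].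
Qed.

Lemma chain_rule_expR k a b : L1loc k -> a <= b ->
  expR (integ k a b) - 1 = integ (fun t => expR (integ k a t) * k t) a b.
Proof.
move=> lk ab.
have := @chain_rule k (fun t => expR (integ k a t) * k t) expR expR 0 a b lk.
rewrite !add0r expR0; apply => //.
- apply: L1locMl => // t; apply: continuous_comp; first exact: integ_continuous.
  exact: continuous_expR.
- by move=> t _; exists 1 => // z _; exact: is_derive_expR.
- by move=> t _; exact: continuous_expR.
- by move=> t _; rewrite add0r.
Qed.

(** With [W = exp (int k)] one has [int k W = W - 1]; so if [N] is the maximum of
    [y / W], the hypothesis at a maximum point gives [N W <= c + N (W - 1)]. *)
Lemma gronwall k y c a b : L1loc k -> (forall t, 0 <= k t) -> continuous y ->
  0 <= c -> (forall t, a <= t <= b -> y t <= c + integ (fun s => k s * y s) a t) ->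
  forall t, a <= t <= b -> y t <= c * expR (integ k a t).
Proof.
move=> lk k0 cy c0 H t tab.
have ab : a <= b by case/andP: tab => /le_trans; apply.
pose W t := expR (integ k a t).
have W0 s : 0 < W s by exact: expR_gt0.
have cW : continuous W.
  by move=> s; apply: continuous_comp; [exact: integ_continuous|exact: continuous_expR].
have cZ : continuous (fun s => y s / W s).
  by move=> s; apply: cvgM; [exact: cy|apply: cvgV; [rewrite gt_eqF|exact: cW]].
have [t1 t1ab Zmax] := EVT_max ab (continuous_subspaceT cZ).
set N := y t1 / W t1 in Zmax.
have yN s : a <= s <= b -> y s <= N * W s.
  by move=> sab; have := Zmax s; rewrite in_itv/= (ler_pdivrMr _ _ (W0 s)); apply.
suff Nc : N <= c.
  by apply: le_trans (yN t tab) _; rewrite ler_wpM2r// ltW.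
have [N0|N0] := leP N 0; first exact: le_trans N0 c0.
rewrite in_itv/= in t1ab; have [at1 t1b] := andP t1ab.
have Ey : y t1 = N * W t1 by rewrite /N divfK// gt_eqF.
have : y t1 <= c + N * (W t1 - 1).
  apply: le_trans (H t1 t1ab) _; rewrite lerD2l /W chain_rule_expR//.
  rewrite -integZ; last exact: L1locMl.
  apply: le_integ; [exact: L1locM|by apply: L1locZ; exact: L1locMl|].
  move=> s /andP[as_ st1]; rewrite mulrA mulrC.
  by rewrite ler_wpM2r// yN// as_ (le_trans st1).
by rewrite Ey mulrBr mulr1; lra.
Qed.

(** Same argument with the decreasing weight [exp (- int k)]; it yields
    uniqueness for Cauchy problems with data at the right end point. *)
Lemma gronwall_backward k y a b : L1loc k -> (forall t, 0 <= k t) -> continuous y ->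
  (forall t, a <= t <= b -> y t <= integ (fun s => k s * y s) t b) ->
  forall t, a <= t <= b -> y t <= 0.
Proof.
move=> lk k0 cy H t tab.
have ab : a <= b by case/andP: tab => /le_trans; apply.
have lk' := L1locN lk.
pose W t := expR (integ (fun s => - k s) a t).
have W0 s : 0 < W s by exact: expR_gt0.
have cW : continuous W.
  by move=> s; apply: continuous_comp; [exact: integ_continuous|exact: continuous_expR].
have cZ : continuous (fun s => y s / W s).
  by move=> s; apply: cvgM; [exact: cy|apply: cvgV; [rewrite gt_eqF|exact: cW]].
have [t1 t1ab Zmax] := EVT_max ab (continuous_subspaceT cZ).
set N := y t1 / W t1 in Zmax.
have yN s : a <= s <= b -> y s <= N * W s.
  by move=> sab; have := Zmax s; rewrite in_itv/= (ler_pdivrMr _ _ (W0 s)); apply.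
suff N0 : N <= 0.
  by apply: le_trans (yN t tab) _; rewrite pmulr_lle0.
rewrite in_itv/= in t1ab; have [at1 t1b] := andP t1ab.
have Ey : y t1 = N * W t1 by rewrite /N divfK// gt_eqF.
have lW : L1loc (fun s => W s * - k s) by exact: L1locMl.
have IW : integ (fun s => W s * - k s) t1 b = W b - W t1.
  apply: (addrI (W t1 - 1)); rewrite [LHS](_ : _ = integ (fun s => W s * - k s) a b).
    by rewrite -chain_rule_expR// [RHS]addrC addrA subrK.
  by rewrite (integ_chasles lW at1 t1b) -chain_rule_expR.
have : y t1 <= N * (W t1 - W b).
  apply: le_trans (H t1 t1ab) _.
  rewrite -(opprB (W b)) -IW mulrN -mulNr -integZ//.
  apply: le_integ; [exact: L1locM|exact: L1locZ|].
  move=> s /andP[t1s sb]; rewrite mulNr mulrN mulrN opprK mulrA mulrC.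
  by rewrite ler_wpM2r// yN// sb (le_trans at1).
by rewrite Ey mulrBr -subr_ge0 addrC addKr oppr_ge0 pmulr_lle0.
Qed.

End Calculus.

(** * The Cauchy problem with an integrable weight *)
Section Cauchy.
Context {R : realType}.
Implicit Types (f q p : R -> R) (x y s t T : R).

Lemma le_pow2_eq0 (X A : R) : (forall n, `|X| <= A / 2 ^+ n) -> X = 0.
Proof.
move=> H; apply/eqP; rewrite -normr_le0; apply/ler_addgt0Pr => e e0; rewrite add0r.
have A0 : 0 <= A by have := H 0; rewrite expr0 divr1; exact: le_trans.
have c0 : 0 < A + 1 by rewrite ltr_wpDl.
have [n _ /(_ n (leqnn n)) /= Hn] :=
  near_infty_natSinv_expn_lt (PosNum (divr_gt0 e0 c0)).
apply: le_trans (H n) _; move: Hn; rewrite div1r ltr_pdivlMr// => Hn.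
apply: le_trans (ltW Hn); rewrite mulrC ler_wpM2l ?invr_ge0 ?exprn_ge0//.
by rewrite lerDl.
Qed.

(** The sequences [u n - 2 D / 2^n] and [u n + 2 D / 2^n] are monotone and
    adjacent, which gives the limit together with the rate of convergence. *)
Lemma geometric_limit (u : nat -> R) (D : R) :
  (forall n, `|u n.+1 - u n| <= D / 2 ^+ n) ->
  exists l, forall n, `|u n - l| <= 2 * D / 2 ^+ n.
Proof.
move=> H.
pose v n := u n - 2 * D / 2 ^+ n; pose w n := u n + 2 * D / 2 ^+ n.
have half n : 2 * D / 2 ^+ n.+1 = D / 2 ^+ n.
  by rewrite exprS -mulf_div divff// mul1r.
have D0 n : 0 <= D / 2 ^+ n by exact: le_trans (H n).
have dbl n : 2 * D / 2 ^+ n = D / 2 ^+ n + D / 2 ^+ n by rewrite -mulrA mulr_natl mulr2n.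
have vS n : v n <= v n.+1.
  rewrite /v half dbl; have := H n; rewrite ler_norml => /andP[h _]; lra.
have wS n : w n.+1 <= w n.
  rewrite /w half dbl; have := H n; rewrite ler_norml => /andP[_ h]; lra.
have vm n m : (n <= m)%N -> v n <= v m.
  move=> /subnK <-; elim: (m - n)%N => // k IH; exact: le_trans IH (vS _).
have wm n m : (n <= m)%N -> w m <= w n.
  move=> /subnK <-; elim: (m - n)%N => // k IH; exact: le_trans (wS _) IH.
have vw n m : v n <= w m.
  apply: (@le_trans _ _ (v (maxn n m))); first by rewrite vm// leq_maxl.
  apply: (@le_trans _ _ (w (maxn n m))); last by rewrite wm// leq_maxr.
  by rewrite /v /w dbl; have := D0 (maxn n m); lra.
exists (sup (range v)) => n.
have S : has_sup (range v).
  by split; [exists (v 0); exists 0|exists (w 0) => _ [k _ <-]].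
have h1 : v n <= sup (range v) by apply: sup_upper_bound => //; exists n.
have h2 : sup (range v) <= w n by apply: ge_sup; [exact: S.1|move=> _ [k _ <-]].
by rewrite ler_norml; move: h1 h2; rewrite /v /w; lra.
Qed.

Section Lipschitz.
Context (G : R -> R) (L : R).
Hypothesis L_ge0 : 0 <= L.
Hypothesis G_lip : forall x y, `|G x - G y| <= L * `|x - y|.

Definition traj x p t : R := x + integ p 0 t.

(** [u = traj x p] solves [u'' + q G(u) = 0], [u(0) = x], [u'(0) = 0].  The
    unknown is the velocity [p], for which the equation is an integral equation
    without second primitives. *)
Definition cauchy_solution q x p := continuous p /\
  forall t, p t = - integ (fun s => q s * G (traj x p s)) 0 t.

Lemma lipschitz_continuous : continuous G.
Proof.
move=> x; apply/cont_epsP => e e0; exists (e / (L + 1)); first by rewrite divr_gt0// ltr_wpDl.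
move=> s; rewrite ltr_pdivlMr ?ltr_wpDl// => sx.
apply: le_lt_trans (G_lip s x) _; apply: le_lt_trans sx.
by rewrite mulrC ler_wpM2l// lerDl.
Qed.

Lemma traj_continuous x p : L1loc p -> continuous (traj x p).
Proof. by move=> lp t; apply: cvgD; [exact: cvg_cst|exact: integ_continuous]. Qed.

Lemma traj0 x p : traj x p 0 = x.
Proof. by rewrite /traj integ_id addr0. Qed.

Lemma Gtraj_continuous x p : L1loc p -> continuous (fun s => G (traj x p s)).
Proof.
move=> lp t; apply: continuous_comp; first exact: traj_continuous.
exact: lipschitz_continuous.
Qed.

Lemma L1loc_force q x p : L1loc q -> L1loc p -> L1loc (fun s => q s * G (traj x p s)).
Proof. by move=> lq lp; apply: L1locM => //; exact: Gtraj_continuous. Qed.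

Section Picard.
Context (q : R -> R) (x : R).
Hypothesis lq : L1loc q.

Let Phi p t : R := - integ (fun s => q s * G (traj x p s)) 0 t.
(** The Picard map is a contraction of ratio 1/2 for the norm weighted by
    [W = exp (2 int kappa)]: a difference of velocities bounded by [c W] moves
    the position at time [s] by at most [s c W(s)], hence the velocity by at most
    [c int kappa W], and [2 int kappa W <= W]. *)
Let kappa s : R := L * `|s| * `|q s|.
Let W t : R := expR (integ (fun s => 2 * kappa s) 0 t).
Let C t : R := `|G x| * integ (fun s => `|q s|) 0 t.

Let Phi_continuous p : L1loc p -> continuous (Phi p).
Proof.
move=> lp t; apply: cvgN; apply: integ_continuous; exact: L1loc_force.
Qed.

Let lkappa : L1loc kappa.
Proof.
apply: L1locMl; last exact: L1loc_norm.
by move=> s; apply: cvgM; [exact: cvg_cst|exact: norm_continuous].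
Qed.

Let W_gt0 t : 0 < W t. Proof. exact: expR_gt0. Qed.

Let kappa_ge0 s : 0 <= kappa s. Proof. by rewrite /kappa !mulr_ge0. Qed.

Let W_continuous : continuous W.
Proof.
move=> s; apply: continuous_comp; last exact: continuous_expR.
by apply: integ_continuous; exact: L1locZ.
Qed.

Let W_nd s t : s <= t -> W s <= W t.
Proof.
move=> st; rewrite ler_expR; apply: le_integ_itv => //; first exact: L1locZ.
by move=> r; rewrite mulr_ge0.
Qed.

Let C_nd s t : s <= t -> C s <= C t.
Proof.
by move=> st; rewrite ler_wpM2l//; apply: le_integ_itv => //; exact: L1loc_norm.
Qed.

Let C_ge0 t : 0 <= C t.
Proof. by rewrite mulr_ge0// integ_ge0. Qed.

Let Phi_contract p1 p2 c t : continuous p1 -> continuous p2 -> 0 <= c -> 0 <= t ->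
  (forall s, 0 <= s <= t -> `|p1 s - p2 s| <= c * W s) ->
  `|Phi p1 t - Phi p2 t| <= c / 2 * W t.
Proof.
move=> cp1 cp2 c0 t0 H.
have lp1 := L1loc_continuous cp1; have lp2 := L1loc_continuous cp2.
rewrite /Phi -opprD normrN -integB; [|exact: L1loc_force..].
have lWk : L1loc (fun s => W s * (2 * kappa s)) by apply: L1locMl => //; exact: L1locZ.
apply: (@le_trans _ _ (integ (fun s => c / 2 * (W s * (2 * kappa s))) 0 t)); last first.
  rewrite integZ// -chain_rule_expR//; last exact: L1locZ.
  by rewrite ler_wpM2l ?divr_ge0// lerBlDr lerDl.
apply: le_normr_integ; [by apply: L1locB; exact: L1loc_force|exact: L1locZ|].
move=> s /andP[s0 st].
rewrite -mulrBr normrM.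
have -> : c / 2 * (W s * (2 * kappa s)) = `|q s| * (L * (c * W s * s)).
  by rewrite /kappa (ger0_norm s0); field.
rewrite ler_wpM2l//; apply: le_trans (G_lip _ _) _; rewrite ler_wpM2l//.
rewrite /traj opprD addrACA subrr add0r -integB//.
have -> : c * W s * s = integ (fun=> c * W s) 0 s by rewrite integ_cst// subr0.
apply: le_normr_integ; [exact: L1locB|exact: L1loc_cst|].
move=> r /andP[r0 rs]; apply: le_trans (H r _) _; first by rewrite r0 (le_trans rs).
by apply: ler_wpM2l; [exact: c0|exact: W_nd].
Qed.

Let P n : R -> R := iter n Phi (fun=> 0).

Let P_continuous n : continuous (P n).
Proof.
elim: n => [|n IH]; first by move=> t; exact: cvg_cst.
by rewrite /P iterS; apply: Phi_continuous; exact: L1loc_continuous.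
Qed.

Let P_neg n t : t < 0 -> P n t = 0.
Proof. by case: n => // n t0; rewrite /P iterS /Phi integ_ge// oppr0. Qed.

Let P_incr n t : `|P n.+1 t - P n t| <= C t * W t / 2 ^+ n.
Proof.
have [t0|t0] := ltP t 0.
  by rewrite !P_neg// subrr normr0 divr_ge0// ?exprn_ge0// mulr_ge0 ?C_ge0// ltW.
elim: n t t0 => [|n IH] t t0.
  rewrite expr0 divr1 subr0.
  have -> : P 1 t = - (G x * integ q 0 t).
    rewrite /P /= /Phi -integZ//; congr (- _); apply: eq_integ => s /andP[s0 _].
    by rewrite /traj integ_cst// mul0r addr0 mulrC.
  rewrite normrN normrM; apply: (@le_trans _ _ (C t)).
    by rewrite ler_wpM2l//; exact: normr_integ.
  rewrite ler_peMr//.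
  rewrite -expR0 ler_expR integ_ge0// => s _; by rewrite mulr_ge0.
have -> : C t * W t / 2 ^+ n.+1 = C t / 2 ^+ n / 2 * W t.
  by rewrite exprS; field; rewrite expf_neq0.
rewrite /P !iterS -iterS; apply: Phi_contract => //.
- exact: (@P_continuous n.+1).
- by rewrite divr_ge0 ?exprn_ge0.
move=> s /andP[s0 st]; apply: le_trans (IH s s0) _.
rewrite mulrAC ler_wpM2r ?(ltW (W_gt0 _))//.
by rewrite ler_wpM2r ?invr_ge0 ?exprn_ge0// C_nd.
Qed.

(** The Picard iterates converge pointwise at a rate that is uniform on every
    half-line bounded above, which gives continuity of the limit. *)
Lemma cauchy_solution_exists : exists p, cauchy_solution q x p.
Proof.
have /choice[p Hp] : forall t, exists l, forall n, `|P n t - l| <= 2 * (C t * W t) / 2 ^+ n.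
  by move=> t; apply: geometric_limit => n; exact: P_incr.
have pow_ge0 n : 0 <= (2 ^+ n)^-1 :> R by rewrite invr_ge0 exprn_ge0.
have cp : continuous p.
  move=> t; apply/cont_epsP => e e0.
  pose A := 2 * (C (t + 1) * W (t + 1)).
  have PA n s : s <= t + 1 -> `|P n s - p s| <= A / 2 ^+ n.
    move=> st; apply: le_trans (Hp s n) _; apply: ler_wpM2r; first exact: pow_ge0.
    apply: ler_wpM2l; first exact: ler0n.
    by apply: ler_pM; rewrite ?C_ge0 ?C_nd ?W_nd// ltW.
  have [n An] : exists n, A / 2 ^+ n < e / 3.
    apply/not_existsP => H; have e30 : 0 < e / 3 by rewrite divr_gt0.
    suff : e / 3 = 0 by move=> E; rewrite E ltxx in e30.
    apply: (@le_pow2_eq0 _ A) => n; rewrite gtr0_norm//.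
    by have /negP := H n; rewrite -leNgt.
  have [d d0 Hd] := (cont_epsP _ _).1 (@P_continuous n t) (e / 3) (divr_gt0 e0 (ltr0n _ 3)).
  exists (Num.min 1 d); first by rewrite lt_min ltr01.
  move=> s; rewrite lt_min => /andP[s1 sd].
  have st : s <= t + 1 by move: s1; rewrite ltr_norml => /andP[_]; lra.
  have t1 : t <= t + 1 by rewrite lerDl.
  have := PA n s st; have := PA n t t1.
  have := Hd s sd; rewrite !ltr_norml !ler_norml => /andP[h1 h2] /andP[h3 h4] /andP[h5 h6].
  by move: An; lra.
exists p; split=> // t; apply/eqP; rewrite -subr_eq0; apply/eqP.
have [t0|t0] := ltP t 0.
  have := Hp t 0; rewrite P_neg// /C integ_ge// mulr0 mul0r mulr0 mul0r normr_le0 sub0r oppr_eq0.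
  by rewrite integ_ge// oppr0 subr0 => /eqP.
apply: (@le_pow2_eq0 _ (2 * (2 * (C t * W t)))) => n.
have h1 := Hp t n.+1.
have h2 : `|P n.+1 t - Phi p t| <= 2 * C t / 2 ^+ n / 2 * W t.
  rewrite {1}/P iterS; apply: Phi_contract => //.
  - exact: P_continuous.
  - by rewrite divr_ge0 ?exprn_ge0// mulr_ge0// C_ge0.
  move=> s /andP[s0 st]; apply: le_trans (Hp s n) _.
  rewrite mulrA mulrAC ler_wpM2r ?(ltW (W_gt0 _))//; apply: ler_wpM2r; first exact: pow_ge0.
  apply: ler_wpM2l; first exact: ler0n.
  exact: C_nd.
have -> : 2 * (2 * (C t * W t)) / 2 ^+ n = 2 * (C t * W t) / 2 ^+ n.+1 +
   (2 * C t / 2 ^+ n / 2 * W t + (C t * W t) * (2 / 2 ^+ n)).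
  by rewrite exprS; field; rewrite expf_neq0.
rewrite -[X in X - _](subrK (P n.+1 t)) -addrA.
apply: le_trans (ler_normD _ _) _; apply: lerD; first by rewrite distrC.
rewrite -[leLHS]addr0; apply: lerD h2 _.
apply: mulr_ge0; first by apply: mulr_ge0; [exact: C_ge0|exact: ltW].
by apply: mulr_ge0; [exact: ler0n|exact: pow_ge0].
Qed.

End Picard.

Lemma cauchy_solution_L1loc q x p : cauchy_solution q x p -> L1loc p.
Proof. by move=> [cp _]; exact: L1loc_continuous. Qed.

Lemma cauchy_solution0 q x p : cauchy_solution q x p -> p 0 = 0.
Proof. by move=> [_ ->]; rewrite integ_id oppr0. Qed.

Lemma cauchy_solution_diff q x p s t : L1loc q -> cauchy_solution q x p ->
  0 <= s -> s <= t -> p t - p s = - integ (fun r => q r * G (traj x p r)) s t.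
Proof.
move=> lq Sp s0 st; have lp := cauchy_solution_L1loc Sp; have [_ E] := Sp.
rewrite !E (integ_chasles (L1loc_force x lq lp) s0 st); ring.
Qed.

Lemma traj_diff x p s t : L1loc p -> 0 <= s -> s <= t ->
  traj x p t - traj x p s = integ p s t.
Proof. by move=> lp s0 st; rewrite /traj (integ_chasles lp s0 st); ring. Qed.

(** Continuous dependence on the initial position and on the weight in a single
    estimate; with [q1 = q2] and [x1 = x2] it contains uniqueness. *)
Lemma cauchy_solution_dependence M T q1 q2 x1 x2 p1 p2 :
  (forall z, `|G z| <= M) -> 0 <= T -> L1loc q1 -> L1loc q2 ->
  cauchy_solution q1 x1 p1 -> cauchy_solution q2 x2 p2 ->
  let I2 := integ (fun s => `|q2 s|) 0 T in
  let A := M * integ (fun s => `|q1 s - q2 s|) 0 T in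
  let B := (`|x1 - x2| + T * A) * expR (T * L * I2) in
  (forall t, 0 <= t <= T -> `|traj x1 p1 t - traj x2 p2 t| <= B) /\
  `|p1 T - p2 T| <= A + L * I2 * B.
Proof.
move=> GM T0 lq1 lq2 S1 S2 I2 A B.
have lp1 := cauchy_solution_L1loc S1; have lp2 := cauchy_solution_L1loc S2.
have [cp1 E1] := S1; have [cp2 E2] := S2.
have M0 : 0 <= M by apply: le_trans (GM 0).
have lq12 := L1loc_norm (L1locB lq1 lq2); have lq2' := L1loc_norm lq2.
pose y t := `|traj x1 p1 t - traj x2 p2 t|.
have cy : continuous y.
  move=> t; apply: (@cvg_comp _ _ _ (fun t => traj x1 p1 t - traj x2 p2 t) Num.norm); last exact: norm_continuous.
  by apply: cvgB; exact: traj_continuous.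
pose J t := integ (fun s => L * `|q2 s| * y s) 0 t.
have lJ : L1loc (fun s => L * `|q2 s| * y s) by apply: L1locM => //; exact: L1locZ.
have J0 r : 0 <= L * `|q2 r| * y r by rewrite !mulr_ge0// /y.
have J_nd s t : s <= t -> J s <= J t by move=> st; exact: le_integ_itv.
have A0 : 0 <= A by rewrite mulr_ge0// integ_ge0.
have pd s : 0 <= s <= T -> `|p1 s - p2 s| <= A + J s.
  move=> /andP[s0 sT]; rewrite E1 E2 -opprD normrN -integB; [|exact: L1loc_force..].
  apply: (@le_trans _ _ (integ (fun r => M * `|q1 r - q2 r| + L * `|q2 r| * y r) 0 s)).
    apply: le_normr_integ; [by apply: L1locB; exact: L1loc_force|by apply: L1locD => //; exact: L1locZ|].
    move=> r _; set u1 := traj x1 p1 r; set u2 := traj x2 p2 r.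
    have -> : q1 r * G u1 - q2 r * G u2 = (q1 r - q2 r) * G u1 + q2 r * (G u1 - G u2) by ring.
    apply: le_trans (ler_normD _ _) _; rewrite !normrM; apply: lerD.
      by rewrite mulrC ler_wpM2r.
    by rewrite [L * _]mulrC -mulrA ler_wpM2l.
  rewrite integD ?integZ//; last exact: L1locZ.
  rewrite lerD// ler_wpM2l//; exact: le_integ_itv.
have uB t : 0 <= t <= T -> y t <= (`|x1 - x2| + T * A) *
    expR (integ (fun s => T * (L * `|q2 s|)) 0 t).
  apply: gronwall => //.
  - by do 2 apply: L1locZ.
  - by move=> s; rewrite !mulr_ge0.
  - by rewrite addr_ge0// mulr_ge0.
  move=> {}t /andP[t0 tT].
  have -> : integ (fun s => T * (L * `|q2 s|) * y s) 0 t = T * J t.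
    by rewrite /J -integZ//; apply: eq_integ => s _; rewrite !mulrA.
  have -> : y t = `|(x1 - x2) + integ (fun s => p1 s - p2 s) 0 t|.
    by rewrite integB// /y /traj; congr (`|_|); ring.
  rewrite -[leRHS]addrA; apply: le_trans (ler_normD _ _) _; rewrite lerD2l -mulrDr.
  apply: (@le_trans _ _ (t * (A + J t))); last first.
    by rewrite ler_wpM2r// addr_ge0// integ_ge0.
  have -> : t * (A + J t) = integ (fun=> A + J t) 0 t by rewrite integ_cst// subr0 mulrC.
  apply: le_normr_integ; [exact: L1locB|exact: L1loc_cst|].
  move=> s /andP[s0 st]; apply: le_trans (pd s _) _; first by rewrite s0 (le_trans st).
  by rewrite lerD2l J_nd.
have yB t : 0 <= t <= T -> y t <= B.
  move=> /andP[t0 tT]; apply: le_trans (uB t _) _; first by rewrite t0.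
  rewrite /B; apply: ler_wpM2l; first by rewrite addr_ge0// mulr_ge0.
  rewrite ler_expR; apply: (@le_trans _ _ (integ (fun s => T * (L * `|q2 s|)) 0 T)).
    by apply: le_integ_itv => //; [do 2 apply: L1locZ|move=> s; rewrite !mulr_ge0].
  by rewrite !integZ ?mulrA//; exact: L1locZ.
split=> //; apply: le_trans (pd T _) _; first by rewrite T0 lexx.
rewrite lerD2l.
have -> : L * I2 * B = integ (fun s => L * B * `|q2 s|) 0 T by rewrite integZ// mulrAC.
apply: le_integ => //; first exact: L1locZ.
move=> s sT; rewrite mulrAC ler_wpM2r// ler_wpM2l//; exact: yB.
Qed.

Hypothesis G_npos : forall z, z <= 0 -> G z = 0.

(** If [u(T) <= 0] and [u'(T) = 0], then [u] and the constant [u(T)], at which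
    [G] vanishes, solve the same problem with data at [T]; by backward uniqueness
    [u] is constant, contradicting [u(0) = x > 0]. *)
Lemma cauchy_solution_end_pos q x p T : L1loc q -> 0 <= T -> 0 < x ->
  cauchy_solution q x p -> p T = 0 -> 0 < traj x p T.
Proof.
move=> lq T0 x0 Sp pT; have lp := cauchy_solution_L1loc Sp.
rewrite ltNge; apply/negP => uT.
pose y t := `|traj x p t - traj x p T|.
have cy : continuous y.
  move=> t; apply: (@cvg_comp _ _ _ (fun t => traj x p t - traj x p T) Num.norm); last exact: norm_continuous.
  by apply: cvgB; [exact: traj_continuous|exact: cvg_cst].
have lq' := L1loc_norm lq.
have lJ : L1loc (fun s => L * `|q s| * y s) by apply: L1locM => //; exact: L1locZ.
have J0 r : 0 <= L * `|q r| * y r by rewrite !mulr_ge0// /y.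
have : y 0 <= 0.
  apply: (@gronwall_backward _ (fun s => T * (L * `|q s|)) y 0 T) => //; last by rewrite lexx.
  - by do 2 apply: L1locZ.
  - by move=> s; rewrite !mulr_ge0.
  move=> t /andP[t0 tT].
  rewrite /y distrC traj_diff//.
  pose J := integ (fun s => L * `|q s| * y s) t T.
  have -> : integ (fun s => T * (L * `|q s|) * `|traj x p s - traj x p T|) t T = T * J.
    by rewrite /J -integZ//; apply: eq_integ => s _; rewrite !mulrA.
  have J_ge0 : 0 <= J by exact: integ_ge0.
  apply: (@le_trans _ _ (J * (T - t))); last first.
    by rewrite mulrC ler_wpM2r// lerBlDr lerDl.
  rewrite -integ_cst//; apply: le_normr_integ => //; first exact: L1loc_cst.
  move=> s /andP[ts sT]; have s0 := le_trans t0 ts.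
  have := cauchy_solution_diff lq Sp s0 sT; rewrite pT sub0r => /oppr_inj ->.
  apply: (@le_trans _ _ (integ (fun r => L * `|q r| * y r) s T)); last exact: le_integ_itv.
  apply: le_normr_integ => //; first exact: L1loc_force.
  move=> r _; rewrite normrM [L * _]mulrC -mulrA ler_wpM2l//.
  by rewrite -[G _]subr0 -(G_npos uT).
rewrite /y traj0 normr_le0 subr_eq0 => /eqP xE.
by rewrite -xE leNgt x0 in uT.
Qed.

(** Once [u <= 0] and [u' <= 0], the affine function with the same data solves
    the equation, since [G] vanishes on its values. *)
Lemma cauchy_solution_stuck q x p s T : L1loc q -> 0 <= s -> s <= T ->
  cauchy_solution q x p -> traj x p s <= 0 -> p s <= 0 -> p T = p s.
Proof.
move=> lq s0 sT Sp us ps; have lp := cauchy_solution_L1loc Sp.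
pose l t := traj x p s + (t - s) * p s.
have l0 t : s <= t -> l t <= 0.
  by move=> st; rewrite -[0]addr0 lerD// mulr_ge0_le0// subr_ge0.
pose y t := `|traj x p t - l t|.
have cy : continuous y.
  move=> t; apply: (@cvg_comp _ _ _ (fun t => traj x p t - l t) Num.norm); last exact: norm_continuous.
  apply: cvgB; first exact: traj_continuous.
  apply: cvgD; first exact: cvg_cst.
  by apply: cvgMl; apply: cvgB; [exact: cvg_id|exact: cvg_cst].
have T0 := le_trans s0 sT.
have lq' := L1loc_norm lq.
have lJ : L1loc (fun s => L * `|q s| * y s) by apply: L1locM => //; exact: L1locZ.
have J0 r : 0 <= L * `|q r| * y r by rewrite !mulr_ge0// /y.
have y0 t : s <= t <= T -> y t <= 0.
  move=> tsT; suff : y t <= 0 * expR (integ (fun s => T * (L * `|q s|)) s t).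
    by rewrite mul0r.
  move: t tsT; apply: gronwall => //.
  - by do 2 apply: L1locZ.
  - by move=> r; rewrite !mulr_ge0.
  move=> t /andP[st tT]; rewrite add0r.
  pose J := integ (fun s => L * `|q s| * y s) s t.
  have -> : integ (fun s => T * (L * `|q s|) * y s) s t = T * J.
    by rewrite /J -integZ//; apply: eq_integ => r _; rewrite !mulrA.
  have J_ge0 : 0 <= J by exact: integ_ge0.
  apply: (@le_trans _ _ (J * (t - s))); last first.
    by rewrite mulrC ler_wpM2r// lerBlDr (le_trans tT)// lerDl.
  have -> : y t = `|integ (fun r => p r - p s) s t|.
    rewrite integB//; last exact: L1loc_cst.
    by rewrite integ_cst// -(traj_diff x lp s0 st) /y /l; congr (`|_|); ring.
  rewrite -integ_cst//; apply: le_normr_integ; [by apply: L1locB => //; exact: L1loc_cst|exact: L1loc_cst|].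
  move=> r /andP[sr rt]; rewrite (cauchy_solution_diff lq Sp s0 sr) normrN.
  apply: (@le_trans _ _ (integ (fun r => L * `|q r| * y r) s r)); last exact: le_integ_itv.
  apply: le_normr_integ => //; first exact: L1loc_force.
  move=> w /andP[sw _]; rewrite normrM [L * _]mulrC -mulrA ler_wpM2l//.
  by rewrite -[G _]subr0 -(G_npos (l0 _ sw)).
apply/eqP; rewrite -subr_eq0 (cauchy_solution_diff lq Sp s0 sT) oppr_eq0; apply/eqP.
rewrite (@eq_integ _ _ (fun=> 0)) ?integ_cst ?mul0r//.
move=> t tsT; have := y0 t tsT; rewrite normr_le0 subr_eq0 => /eqP ->.
by rewrite G_npos ?mulr0// l0//; case/andP: tsT.
Qed.

End Lipschitz.
End Cauchy.

(** * Derivatives within a set, and the extended nonlinearity *)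
Section Derivatives.
Context {R : realType}.
Implicit Types (f : R -> R) (x l : R) (D : set R).

Lemma is_derive_epsP f x l :
  (forall e, 0 < e -> exists2 d, 0 < d & forall y, y != x -> `|y - x| < d ->
     `|(f y - f x) / (y - x) - l| < e) -> is_derive x 1 f l.
Proof.
move=> H.
have cv : h^-1 *: (f (h *: (1 : R) + x) - f x) @[h --> 0^'] --> l.
  apply/cvgrPdistC_lt => e e0; have [d d0 Hd] := H e e0.
  exists d => // h /=; rewrite sub0r normrN => hd h0.
  have := Hd (h + x); rewrite addrK mulrC [h *: _]mulr1; apply => //.
  by rewrite -subr_eq0 addrK.
apply: DeriveDef; first by apply/cvg_ex; exists l; exact: cv.
by apply/cvg_lim; [exact: Rhausdorff|exact: cv].
Qed.

Lemma has_derivative_within_epsP D f x l : has_derivative_within D f x l <->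
  (forall e, 0 < e -> exists2 d, 0 < d & forall y, D y -> y != x -> `|y - x| < d ->
     `|(f y - f x) / (y - x) - l| < e).
Proof.
split=> [/cvgrPdistC_lt H e e0|H].
  have [d /= d0 Hd] := H e e0.
  by exists d => // y Dy yx yd; apply: Hd => //=; rewrite distrC.
apply/cvgrPdistC_lt => e e0; have [d d0 Hd] := H e e0.
by exists d => // y /=; rewrite distrC => yd yx Dy; exact: Hd.
Qed.

Lemma derivable_has_derivative_within D f x : derivable f x 1 ->
  has_derivative_within D f x (derive1 f x).
Proof.
move=> df; have /cvgrPdistC_lt H :
    h^-1 *: (f (h *: (1 : R) + x) - f x) @[h --> 0^'] --> derive1 f x.
  by rewrite derive1E; exact: df.
apply/has_derivative_within_epsP => e e0; have [d /= d0 Hd] := H e e0.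
exists d => // y _ yx yd.
have := Hd (y - x); rewrite /= sub0r normrN => /(_ yd).
by rewrite subr_eq0 => /(_ yx); rewrite [_ *: 1]mulr1 subrK mulrC.
Qed.

Lemma continuous_bounded_itv f (a b : R) : {within `[a, b], continuous f} ->
  exists2 M, 0 <= M & forall x, a <= x <= b -> `|f x| <= M.
Proof.
move=> cf; have /compact_bounded[M [_ HM]] := continuous_compact cf (@segment_compact _ a b).
exists (`|M| + 1) => [|x xab]; first by rewrite addr_ge0.
apply: HM; last by exists x.
by apply: le_lt_trans (ler_norm M) _; rewrite ltrDl.
Qed.

End Derivatives.

Section Nonlinearity.
Context {R : realType} (g g' : R -> R).
Hypotheses (g_C1 : C1_on `[0, +oo[ g g') (g_at0 : g 0 = 0).

(** [g] continued by 0 to the negative reals ([g 0 = 0]), to have global solutions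
    of the Cauchy problem. *)
Definition gext (z : R) : R := g (Num.max z 0).

Lemma gext_npos z : z <= 0 -> gext z = 0.
Proof. by move=> z0; rewrite /gext max_r. Qed.

Lemma gextE z : 0 <= z -> gext z = g z.
Proof. by move=> z0; rewrite /gext max_l. Qed.

Lemma gext_is_derive (z : R) : 0 < z -> is_derive z 1 gext (g' z).
Proof.
move=> z0; have [dg _] := g_C1.
have := dg z; rewrite /= in_itv/= andbT => /(_ (ltW z0))/has_derivative_within_epsP H.
apply: is_derive_epsP => e e0; have [d d0 Hd] := H e e0.
exists (Num.min z d) => [|y yz]; first by rewrite lt_min z0.
rewrite lt_min => /andP[yz' yd].
have y0 : 0 <= y by move: yz'; rewrite ltr_norml => /andP[h _]; lra.
by rewrite !gextE ?(ltW z0)//; apply: Hd; rewrite //= in_itv/= y0.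
Qed.

(** At 0 the one-sided derivative of [g] bounds the difference quotient. *)
Lemma gext_continuous : continuous gext.
Proof.
move=> z; have [z0|z0|->] := ltgtP z 0.
- apply/cont_epsP => e e0; exists (- z); first by rewrite oppr_gt0.
  move=> s; rewrite ltr_norml => /andP[_ sz].
  by rewrite !gext_npos ?subrr ?normr0 ?ltW//; lra.
- apply/differentiable_continuous/derivable1_diffP.
  by have [] := gext_is_derive z0.
- apply/cont_epsP => e e0; have [dg _] := g_C1.
  have := dg 0; rewrite /= in_itv/= lexx => /(_ isT)/has_derivative_within_epsP H.
  have [d d0 Hd] := H 1 ltr01.
  have l0 : 0 < `|g' 0| + 1 by rewrite ltr_wpDl.
  exists (Num.min d (e / (`|g' 0| + 1))); first by rewrite lt_min d0 divr_gt0.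
  move=> s; rewrite subr0 lt_min => /andP[sd se].
  rewrite (gext_npos (lexx 0)) subr0.
  have [s0|s0] := leP s 0; first by rewrite gext_npos// normr0.
  rewrite gextE ?ltW//.
  have := Hd s; rewrite /= in_itv/= (ltW s0) subr0 g_at0 subr0 (gt_eqF s0) => /(_ isT isT sd) H1.
  have H2 : `|g s / s| < `|g' 0| + 1.
    rewrite -(subrK (g' 0) (g s / s)); apply: le_lt_trans (ler_normD _ _) _.
    by rewrite addrC ltrD2l.
  move: H2 se; rewrite normrM normfV (gtr0_norm s0) ltr_pdivrMr// ltr_pdivlMr//.
  by rewrite [s * _]mulrC; exact: lt_trans.
Qed.

Lemma g'_continuous z : 0 < z -> {for z, continuous g'}.
Proof.
move=> z0; have [_] := g_C1 => /continuous_within_itvcyP[H _].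
by apply: H; rewrite in_itv/= z0.
Qed.

Lemma gext_mean_value (a b : R) : 0 <= a -> a <= b ->
  exists2 c, a <= c <= b & gext b - gext a = g' c * (b - a) /\ (a < b -> a < c < b).
Proof.
move=> a0; rewrite le_eqVlt => /predU1P[<-|ab].
  by exists a; rewrite ?lexx// !subrr mulr0; split=> //; rewrite ltxx.
have [x||c cab E] := @MVT R gext g' a b ab.
- rewrite in_itv/= => /andP[ax _]; exact: gext_is_derive (le_lt_trans a0 ax).
- by apply: continuous_subspaceT => x; exact: gext_continuous.
- by exists c; [rewrite !ltW ?(itvP cab)|split=> //; rewrite !(itvP cab)].
Qed.

Lemma gext_lipschitz_on (e a b : R) : 0 <= a -> a <= b ->
  (forall z, a < z < b -> `|g' z| <= e) -> `|gext b - gext a| <= e * (b - a).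
Proof.
move=> a0 ab He; have [c _ [-> cab]] := gext_mean_value a0 ab.
move: ab; rewrite le_eqVlt => /predU1P[->|ab]; first by rewrite subrr !mulr0 normr0.
by rewrite normrM [X in _ * X]gtr0_norm ?subr_gt0// ler_pM2r ?subr_gt0// He// cab.
Qed.

Hypothesis g'_cvgy : g' u @[u --> +oo] --> (0 : R).
Hypothesis g'_cvg0 : g' u @[u --> 0^'+] --> (0 : R).

Lemma g'_small_near0 (e : R) : 0 < e ->
  exists2 d, 0 < d & forall z, 0 < z < d -> `|g' z| <= e.
Proof.
move=> e0; have /cvgrPdistC_le/(_ e e0)[d /= d0 Hd] := g'_cvg0.
exists d => // z /andP[z0 zd]; rewrite -[g' z]subr0; apply: Hd => //=.
by rewrite sub0r normrN gtr0_norm.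
Qed.

Lemma g'_small_nearoo (e : R) : 0 < e ->
  exists2 B, 0 < B & forall z, B < z -> `|g' z| <= e.
Proof.
move=> e0; have /cvgrPdistC_le/(_ e e0)[B [_ HB]] := g'_cvgy.
exists (Num.max 1 B) => [|z]; first by rewrite lt_max ltr01.
rewrite gt_max => /andP[_ Bz]; rewrite -[g' z]subr0; exact: HB.
Qed.

Lemma gext_lipschitz : exists2 L, 0 <= L & forall x y, `|gext x - gext y| <= L * `|x - y|.
Proof.
have [B B0 HB] := g'_small_nearoo ltr01.
have [M M0 HM] : exists2 M, 0 <= M & forall x, 0 <= x <= B -> `|g' x| <= M.
  apply: continuous_bounded_itv; have [_ cg'] := g_C1.
  by apply: continuous_subspaceW cg' => x /=; rewrite !in_itv/= => /andP[->].
have g'L z : 0 < z -> `|g' z| <= M + 1.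
  move=> z0; have [zB|Bz] := leP z B.
    by apply: le_trans (HM z _) _; rewrite ?zB ?(ltW z0)// lerDl.
  by apply: le_trans (HB z Bz) _; rewrite lerDr.
have L0 : 0 <= M + 1 by rewrite addr_ge0.
exists (M + 1) => //.
have key x y : x <= y -> `|gext y - gext x| <= (M + 1) * (y - x).
  move=> xy; have [x0|x0] := leP 0 x.
    apply: gext_lipschitz_on => // z /andP[xz _]; exact: g'L (le_lt_trans x0 xz).
  rewrite (gext_npos (ltW x0)) subr0; have [y0|y0] := leP y 0.
    by rewrite gext_npos// normr0 mulr_ge0// subr_ge0.
  rewrite -[gext y]subr0 -(gext_npos (lexx 0)).
  apply: le_trans (gext_lipschitz_on (lexx 0) (ltW y0) _) _.
    by move=> z /andP[z0 _]; exact: g'L.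
  by rewrite ler_wpM2l// lerD2l lerN2 ltW.
move=> x y; have [xy|/ltW yx] := leP x y.
  by rewrite distrC [`|x - y|]distrC [`|y - x|]ger0_norm ?subr_ge0// key.
by rewrite [`|x - y|]ger0_norm ?subr_ge0// key.
Qed.

(** Past [rho] the function decreases, so it is bounded by its values on [[0, rho]]. *)
Lemma gext_bounded : (exists2 rho : R, 0 < rho & forall u : R, rho < u -> g' u < 0) ->
  (forall u : R, 0 < u -> 0 < g u) -> exists M, forall z, `|gext z| <= M.
Proof.
move=> [rho rho0 Hrho] gpos.
have [M M0 HM] : exists2 M, 0 <= M & forall x, 0 <= x <= rho -> `|gext x| <= M.
  by apply: continuous_bounded_itv; apply: continuous_subspaceT => x; exact: gext_continuous.
exists M => z; have [z0|z0] := leP z 0; first by rewrite gext_npos// normr0.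
have [zr|rz] := leP z rho; first by rewrite HM// zr ltW.
apply: le_trans (HM rho _); last by rewrite lexx ltW.
have gp u : 0 < u -> 0 < gext u by move=> u0; rewrite gextE ?gpos// ltW.
rewrite !gtr0_norm ?gp// -subr_le0.
have [c _ [-> /(_ rz)/andP[rc _]]] := gext_mean_value (ltW rho0) (ltW rz).
by apply: mulr_le0_ge0; [exact: ltW (Hrho c rc)|rewrite subr_ge0 ltW].
Qed.

End Nonlinearity.

(** * Signs of the shooting function *)
Section Shooting.
Context {R : realType} (G G' : R -> R) (L M T : R).
Hypothesis T_gt0 : 0 < T.
Hypothesis L_ge0 : 0 <= L.
Hypothesis G_lip : forall x y, `|G x - G y| <= L * `|x - y|.
Hypothesis G_bnd : forall z, `|G z| <= M.
Hypothesis G_npos : forall z, z <= 0 -> G z = 0.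
Hypothesis G_pos : forall z, 0 < z -> 0 < G z.
Hypothesis G_derive : forall z : R, 0 < z -> is_derive z 1 G (G' z).
Hypothesis G'_cont : forall z, 0 < z -> {for z, continuous G'}.
Hypothesis G_lip_on : forall e a b, 0 <= a -> a <= b ->
  (forall z, a < z < b -> `|G' z| <= e) -> `|G b - G a| <= e * (b - a).

Let G_cont : continuous G := lipschitz_continuous L_ge0 G_lip.

Let G_ge0 z : 0 <= G z.
Proof. by have [/G_npos ->|/G_pos/ltW] := leP z 0. Qed.

Let T_ge0 : 0 <= T := ltW T_gt0.

(** The product rule for [v = u' / G(u)] gives [v' = - q - G'(u) v^2].  The
    function [r] is [G'(u) v^2] on [[0, T]], made continuous on the line. *)
Lemma logarithmic_derivative q x p : L1loc q -> cauchy_solution G q x p ->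
  (forall t, 0 <= t <= T -> 0 < traj x p t) ->
  exists r : R -> R, [/\ continuous r,
    forall t, 0 <= t <= T -> r t = G' (traj x p t) * (p t / G (traj x p t)) ^+ 2 &
    forall t, 0 <= t <= T -> p t / G (traj x p t) = - integ q 0 t - integ r 0 t].
Proof.
move=> lq Sp u0; have lp := cauchy_solution_L1loc Sp.
have cu : continuous (traj x p) by exact: traj_continuous.
have [cp Ep] := Sp.
have [t1 t1T umin] := EVT_min T_ge0 (continuous_subspaceT cu).
rewrite in_itv/= in t1T.
pose m := traj x p t1; have m0 : 0 < m by exact: u0.
(* Truncating [u] at its minimum on [0, T] keeps [1 / G(u)] continuous everywhere. *)
pose w s := Num.max (traj x p s) m.
have wu s : 0 <= s <= T -> w s = traj x p s.
  by move=> sT; rewrite /w max_l//; apply: umin; rewrite in_itv.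
have w0 s : 0 < w s by rewrite lt_max m0 orbT.
have cw : continuous w.
  by move=> s; apply: (@continuous_max _ _ (traj x p) (fun=> m)); [exact: cu|exact: cvg_cst].
have cGw : continuous (fun s => G (w s)).
  by move=> s; apply: continuous_comp; [exact: cw|exact: G_cont].
have cG'w : continuous (fun s => G' (w s)).
  by move=> s; apply: continuous_comp; [exact: cw|exact: G'_cont].
have Gw0 s : 0 < G (w s) by exact: G_pos.
have civ : continuous (fun s => (G (w s))^-1).
  by move=> s; apply: cvgV; [rewrite gt_eqF|exact: cGw].
pose r s := G' (w s) * (p s / G (w s)) ^+ 2.
have cr : continuous r.
  move=> s; rewrite /r; under eq_fun do rewrite expr2.
  have cv : {for s, continuous (fun s => p s / G (w s))} by apply: cvgM; [exact: cp|exact: civ].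
  by apply: cvgM; [exact: cG'w|apply: cvgM; exact: cv].
pose h s := (- (G (w s))^-1 * (G (w s))^-1 * G' (w s)) * p s.
have ch : continuous h.
  move=> s; apply: cvgM; last exact: cp.
  apply: cvgM; last exact: cG'w.
  by apply: cvgM; [apply: cvgN; exact: civ|exact: civ].
have lh := L1loc_continuous ch.
pose phi z := (G z)^-1; pose phi' z := - (G z)^-1 * (G z)^-1 * G' z.
have dphi (z : R) : 0 < z -> is_derive z 1 phi (phi' z).
  move=> z0; have Gz0 : G z != 0 by rewrite gt_eqF// G_pos.
  have [dG EG] := G_derive z0.
  apply: DeriveDef; first exact: derivableV.
  rewrite deriveV// EG /phi' /GRing.scale/=.
  by congr (_ * _); rewrite expr2 invfM mulNr.
have hint s : 0 <= s <= T -> (G (traj x p s))^-1 = (G x)^-1 + integ h 0 s.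
  move=> /andP[s0 sT].
  suff E : (G (traj x p s))^-1 - (G x)^-1 = integ h 0 s by rewrite -E addrC subrK.
  apply: (@chain_rule R p h phi phi' x 0 s) => //.
  - move=> t /andP[t0 ts].
    have ut0 : 0 < traj x p t by apply: u0; rewrite t0 (le_trans ts).
    exists (traj x p t) => // z.
    rewrite -/(traj x p t) ltr_norml => /andP[h1 _]; apply: dphi; lra.
  - move=> t /andP[t0 ts]; rewrite -/(traj x p t).
    have ut0 : 0 < traj x p t by apply: u0; rewrite t0 (le_trans ts).
    have Gu0 : G (traj x p t) != 0 by rewrite gt_eqF// G_pos.
    have cV : {for traj x p t, continuous (fun z => (G z)^-1)}.
      by apply: cvgV => //; exact: G_cont.
    apply: cvgM; last exact: G'_cont.
    by apply: cvgM; [apply: cvgN; exact: cV|exact: cV].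
  - by move=> t /andP[t0 ts]; rewrite /h wu// t0 (le_trans ts).
exists r; split=> //; first by move=> t tT; rewrite /r wu.
move=> t /andP[t0 tT].
have lf : L1loc (fun s => - (q s * G (traj x p s))).
  by apply: L1locN; exact: (L1loc_force L_ge0 G_lip).
have := @product_rule R p (fun s => (G (traj x p s))^-1) _ h 0 (G x)^-1 0 t lf lh t0.
rewrite (cauchy_solution0 Sp) mul0r subr0 => ->.
- rewrite -opprD -integD//; last exact: L1loc_continuous.
  rewrite -integN; last by apply: L1locD => //; exact: L1loc_continuous.
  apply: eq_integ => s /andP[s0 st].
  have sT : 0 <= s <= T by rewrite s0 (le_trans st).
  rewrite /h /r wu//; have := gt_eqF (G_pos (u0 s sT)).
  by move: (G _) => z /negbT z0; field.
- by move=> s _; rewrite add0r Ep integN//; exact: (L1loc_force L_ge0 G_lip).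
- by move=> s /andP[s0 st]; apply: hint; rewrite s0 (le_trans st).
Qed.

(** Let [m] be the maximum of [G(u)].  Then [|u'| <= m Q], so [u] varies by at most
    [T m Q] and [G(u)] by at most [e T m Q <= m / 2]; hence [G(u) >= m / 2] and
    [|u' / G(u)| <= 2 Q].  Comparing with the maximum avoids any assumption on
    the size of [G] relative to [G']. *)
Lemma shooting_estimate e q x p : L1loc q -> cauchy_solution G q x p ->
  (forall t, 0 <= t <= T -> 0 < traj x p t) -> 0 <= e ->
  (forall s t z, 0 <= s <= T -> 0 <= t <= T -> traj x p s <= z -> z <= traj x p t ->
    `|G' z| <= e) ->
  let Q := integ (fun s => `|q s|) 0 T in
  e * (T * Q) <= 1 / 2 ->
  `|p T / G (traj x p T) + integ q 0 T| <= e * T * (2 * Q) ^+ 2.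
Proof.
move=> lq Sp u0 e0 He Q eQ; have lp := cauchy_solution_L1loc Sp.
have cGu : continuous (fun s => G (traj x p s)) by exact: (Gtraj_continuous L_ge0 G_lip).
have lf := L1loc_force L_ge0 G_lip x lq lp.
have [cp Ep] := Sp.
have [t1 t1T Gmax] := EVT_max T_ge0 (continuous_subspaceT cGu).
rewrite in_itv/= in t1T; set m := G (traj x p t1) in Gmax.
have m0 : 0 < m by apply: G_pos; exact: u0.
have Gm s : 0 <= s <= T -> G (traj x p s) <= m by move=> sT; apply: Gmax; rewrite in_itv.
have Q0 : 0 <= Q by apply: integ_ge0.
have lq' := L1loc_norm lq.
have pb s : 0 <= s <= T -> `|p s| <= m * Q.
  move=> /andP[s0 sT]; rewrite Ep normrN.
  apply: (@le_trans _ _ (integ (fun s => m * `|q s|) 0 s)).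
    apply: le_normr_integ => //; first exact: L1locZ.
    move=> r /andP[r0 rs]; rewrite normrM mulrC ler_wpM2r// ger0_norm//.
    by apply: Gm; rewrite r0 (le_trans rs).
  rewrite integZ//; apply: ler_wpM2l; first exact: ltW.
  by apply: le_integ_itv.
have ub0 s t : 0 <= s -> s <= t -> t <= T -> `|traj x p t - traj x p s| <= T * (m * Q).
  move=> s0 st tT; rewrite traj_diff//.
  apply: (@le_trans _ _ (m * Q * (t - s))).
    rewrite -integ_cst//; apply: le_normr_integ => //; first exact: L1loc_cst.
    by move=> r /andP[sr rt]; apply: pb; rewrite (le_trans s0) ?(le_trans rt).
  rewrite mulrC; apply: ler_wpM2r; first by apply: mulr_ge0; [exact: ltW|].
  by rewrite lerBlDr (le_trans tT)// lerDl.
have ub s t : 0 <= s <= T -> 0 <= t <= T -> `|traj x p t - traj x p s| <= T * (m * Q).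
  move=> /andP[s0 sT] /andP[t0 tT]; have [st|/ltW ts] := leP s t; first exact: ub0.
  by rewrite distrC; exact: ub0.
have Gd s t : 0 <= s <= T -> 0 <= t <= T -> traj x p s <= traj x p t ->
    `|G (traj x p t) - G (traj x p s)| <= m / 2.
  move=> sT tT st; apply: (@le_trans _ _ (e * (traj x p t - traj x p s))).
    apply: G_lip_on => //; first by apply/ltW/u0.
    by move=> z /andP[/ltW h1 /ltW h2]; exact: (He s t).
  apply: (@le_trans _ _ (e * (T * (m * Q)))).
    by apply: ler_wpM2l => //; apply: le_trans (ler_norm _) (ub s t sT tT).
  have -> : e * (T * (m * Q)) = e * (T * Q) * m by ring.
  have -> : m / 2 = 1 / 2 * m by ring.
  by apply: ler_wpM2r => //; exact: ltW.
have Glow s : 0 <= s <= T -> m / 2 <= G (traj x p s).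
  move=> sT.
  have : `|m - G (traj x p s)| <= m / 2.
    have [h|/ltW h] := leP (traj x p s) (traj x p t1); first exact: Gd.
    by rewrite distrC; exact: Gd.
  by rewrite ler_norml => /andP[_]; lra.
have [r [cr Er Ev]] := logarithmic_derivative lq Sp u0.
have TT : 0 <= T <= T by rewrite T_ge0 lexx.
rewrite Ev// addrAC addNr add0r normrN.
apply: (@le_trans _ _ (integ (fun=> e * (2 * Q) ^+ 2) 0 T)); last first.
  by rewrite integ_cst// subr0 mulrAC.
apply: le_normr_integ; [exact: L1loc_continuous|exact: L1loc_cst|].
move=> s sT; rewrite Er// normrM normrX.
have vb : `|p s / G (traj x p s)| <= 2 * Q.
  rewrite normrM normfV.
  have Gs0 : 0 < G (traj x p s) by apply: G_pos; exact: u0.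
  rewrite (gtr0_norm Gs0) ler_pdivrMr//; apply: le_trans (pb s sT) _.
  have -> : m * Q = 2 * Q * (m / 2) by field.
  by apply: ler_wpM2l; [exact: mulr_ge0|exact: Glow].
apply: ler_pM => //; first exact: (He s s).
by apply: lerXn2r => //; rewrite nnegrE// mulr_ge0.
Qed.

Lemma continuous_integ_eq0 (r : R -> R) : continuous r ->
  (forall t, 0 <= t <= T -> 0 <= r t) -> integ r 0 T = 0 ->
  forall t, 0 <= t <= T -> r t = 0.
Proof.
move=> cr r0 I0 t tT; apply/eqP; rewrite eq_le r0// andbT leNgt; apply/negP => rt.
have lr := L1loc_continuous cr.
have rt2 : 0 < r t / 2 by rewrite divr_gt0.
have [d d0 Hd] := (cont_epsP _ _).1 (cr t) _ rt2.
have [t0 tT'] := andP tT.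
pose a := Num.max 0 (t - d / 2); pose b := Num.min T (t + d / 2).
have a0 : 0 <= a by rewrite le_max lexx.
have bT : b <= T by rewrite ge_min lexx.
have at_ : a <= t by rewrite ge_max t0 lerBlDr lerDl divr_ge0// ltW.
have tb : t <= b by rewrite le_min tT' lerDl divr_ge0// ltW.
have ta : t - d / 2 <= a by rewrite le_max lexx orbT.
have bt : b <= t + d / 2 by rewrite ge_min lexx orbT.
have ab : a < b.
  rewrite lt_min !gt_max T_gt0/=.
  have h1 : t - d / 2 < T by move: d0 tT'; lra.
  have h2 : 0 < t + d / 2 by move: d0 t0; lra.
  by rewrite h1 h2/=; move: d0; lra.
suff : 0 < integ r 0 T by rewrite I0 ltxx.
rewrite (integ_chasles lr a0 (le_trans (ltW ab) bT)) (integ_chasles lr (ltW ab) bT).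
have h1 : 0 <= integ r 0 a.
  by apply: integ_ge0 => s /andP[s0 sa]; apply: r0; rewrite s0 (le_trans sa)// (le_trans at_).
have h2 : 0 <= integ r b T.
  by apply: integ_ge0 => s /andP[bs sT]; apply: r0; rewrite sT andbT (le_trans _ bs)// (le_trans t0).
have h3 : r t / 2 * (b - a) <= integ r a b.
  rewrite -(integ_cst _ (ltW ab)); apply: le_integ => //; first exact: L1loc_cst.
  move=> s /andP[as_ sb].
  have : `|s - t| < d by rewrite ltr_norml; apply/andP; split; lra.
  by move=> /Hd; rewrite ltr_norml => /andP[h _]; lra.
have h4 : 0 < r t / 2 * (b - a) by rewrite mulr_gt0// subr_gt0.
by move: h1 h2 h3 h4; lra.
Qed.

(** If [v] vanished identically, [u] would be constant and [int_0^tau q] would be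
    0; so [int G'(u) v^2] has strictly the sign of [G'(u)].  The factor [sg]
    covers both signs. *)
Lemma shooting_sign_zero_mean (sg : R) q x p tau : L1loc q -> cauchy_solution G q x p ->
  (forall t, 0 <= t <= T -> 0 < traj x p t) ->
  (forall t, 0 <= t <= T -> 0 < sg * G' (traj x p t)) ->
  integ q 0 T = 0 -> 0 <= tau <= T -> integ q 0 tau != 0 ->
  sg * p T < 0.
Proof.
move=> lq Sp u0 sG' q0 tauT qtau; have lp := cauchy_solution_L1loc Sp.
have TT : 0 <= T <= T by rewrite T_ge0 lexx.
have GT0 := G_pos (u0 T TT).
have [r [cr Er Ev]] := logarithmic_derivative lq Sp u0.
have csr : continuous (fun t => sg * r t).
  by move=> t; apply: cvgM; [exact: cvg_cst|exact: cr].
have sr0 t : 0 <= t <= T -> 0 <= sg * r t.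
  move=> tT; rewrite Er// mulrA; apply: mulr_ge0; last exact: sqr_ge0.
  by apply: ltW; exact: sG'.
have I0 : 0 <= integ (fun t => sg * r t) 0 T by exact: integ_ge0.
have lr := L1loc_continuous cr.
have Ev' : sg * p T = - (G (traj x p T) * integ (fun t => sg * r t) 0 T).
  have := Ev T TT; rewrite q0 oppr0 add0r => E.
  have -> : p T = p T / G (traj x p T) * G (traj x p T) by rewrite divfK// gt_eqF.
  by rewrite E integZ//; ring.
rewrite Ev' oppr_lt0 mulr_gt0// lt_neqAle I0 andbT eq_sym.
apply/eqP => /(continuous_integ_eq0 csr sr0) r0.
have p0 t : 0 <= t <= T -> p t = 0.
  move=> tT; have := r0 t tT; rewrite Er// mulrA => /eqP.
  rewrite mulf_eq0 (gt_eqF (sG' t tT))/= expf_eq0/= mulf_eq0 invr_eq0.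
  by rewrite (gt_eqF (G_pos (u0 t tT))) orbF => /eqP.
have [tau0 tauT'] := andP tauT.
have ux t : 0 <= t <= tau -> traj x p t = x.
  move=> /andP[t0 ttau]; rewrite /traj (@eq_integ _ _ (fun=> 0)) ?integ_cst// ?mul0r ?addr0//.
  by move=> s /andP[s0 st]; apply: p0; rewrite s0 (le_trans st)// (le_trans ttau).
have : G x * integ q 0 tau = 0.
  have [_ Ep] := Sp; have := Ep tau; rewrite p0// => /esym/eqP; rewrite oppr_eq0 => /eqP E.
  rewrite -integZ// -[RHS]E; apply: eq_integ => s sT; rewrite ux//; exact: mulrC.
have x0 : 0 < x by rewrite -(traj0 x p); apply: u0; rewrite lexx.
by move/eqP; rewrite mulf_eq0 (gt_eqF (G_pos x0)) (negPf qtau).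
Qed.

Hypothesis G'_small0 : forall e, 0 < e ->
  exists2 d, 0 < d & forall z, 0 < z < d -> `|G' z| <= e.
Hypothesis G'_smalloo : forall e, 0 < e ->
  exists2 B, 0 < B & forall z, B < z -> `|G' z| <= e.

Lemma cauchy_solution_zero q : cauchy_solution G q 0 (fun=> 0).
Proof.
split=> [t|t]; first exact: cvg_cst.
rewrite (@eq_integ _ _ (fun=> 0)).
  have [t0|t0] := leP 0 t; last by rewrite integ_ge// oppr0.
  by rewrite integ_cst// mul0r oppr0.
by move=> s /andP[s0 _]; rewrite /traj integ_cst// mul0r addr0 G_npos ?mulr0.
Qed.

(** By Gronwall [|u| <= E x] with [E] independent of [x], while [|G(z)| <= e |z|]
    for small [z]; so [|u - x| <= e T Q E x <= x / 2]. *)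
Lemma small_data_stay_small q d : L1loc q -> 0 < d ->
  exists2 x, 0 < x < d & forall p, cauchy_solution G q x p ->
    forall t, 0 <= t <= T -> 0 < traj x p t < d.
Proof.
move=> lq d0; have lq' := L1loc_norm lq.
pose Q := integ (fun s => `|q s|) 0 T; pose E := expR (T * L * Q).
have Q0 : 0 <= Q by apply: integ_ge0.
have E0 : 0 < E by exact: expR_gt0.
have TQE0 : 0 <= T * Q * E by rewrite !mulr_ge0// ltW.
pose e := (2 * (T * Q * E + 1))^-1.
have e0 : 0 < e by rewrite invr_gt0 mulr_gt0// ltr_wpDl.
have eTQE : e * (T * Q * E) <= 1 / 2.
  rewrite mulrC ler_pdivrMr; last by rewrite mulr_gt0// ltr_wpDl.
  lra.
have [rho rho0 Hrho] := G'_small0 e0.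
have Ge z : `|z| < rho -> `|G z| <= e * `|z|.
  move=> zr; have [z0|z0] := leP z 0.
    by rewrite G_npos// normr0 mulr_ge0// ltW.
  rewrite gtr0_norm// in zr *; rewrite -[G z]subr0 -(G_npos (lexx 0)) -[X in e * X]subr0.
  apply: G_lip_on => //; first exact: ltW.
  by move=> w /andP[w0 wz]; apply: Hrho; rewrite w0 (lt_trans wz).
pose x := Num.min d (rho / E) / 2.
have x0 : 0 < x by rewrite divr_gt0// lt_min d0 divr_gt0.
have xd : x <= d / 2 by rewrite ler_pM2r ?invr_gt0// ge_min lexx.
have xE : x * E < rho.
  have : x <= rho / E / 2 by rewrite ler_pM2r ?invr_gt0// ge_min lexx orbT.
  rewrite -(@ler_pM2r _ E)// => /le_lt_trans; apply.
  have -> : rho / E / 2 * E = rho / 2 by field; rewrite gt_eqF.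
  by move: rho0; lra.
exists x => [|p Sp t tT]; first by rewrite x0/=; move: d0 xd; lra.
have lp := cauchy_solution_L1loc Sp; have [cp Ep] := Sp.
have [Hu _] := cauchy_solution_dependence L_ge0 G_lip G_bnd T_ge0 lq lq Sp (cauchy_solution_zero q).
have ub s : 0 <= s <= T -> `|traj x p s| <= x * E.
  move=> sT; have := Hu s sT.
  have -> : traj 0 (fun=> 0) s = 0 :> R.
    by rewrite /traj integ_cst ?mul0r ?addr0//; case/andP: sT.
  rewrite !subr0 (gtr0_norm x0) (@eq_integ _ _ (fun=> 0) 0 T); last first.
    by move=> r _; rewrite subrr normr0.
  by rewrite integ_cst// mul0r !mulr0 addr0.
have c0 : 0 <= e * (x * E) by apply: mulr_ge0; [exact: ltW|apply: mulr_ge0; exact: ltW].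
have pb s : 0 <= s <= T -> `|p s| <= e * (x * E) * Q.
  move=> /andP[s0 sT]; rewrite Ep normrN.
    apply: (@le_trans _ _ (integ (fun s => e * (x * E) * `|q s|) 0 s)).
    apply: le_normr_integ; [exact: (L1loc_force L_ge0 G_lip)|exact: L1locZ|].
    move=> r /andP[r0 rs]; rewrite normrM mulrC ler_wpM2r//.
    have rT : 0 <= r <= T by rewrite r0 (le_trans rs).
    apply: le_trans (Ge _ (le_lt_trans (ub r rT) xE)) _.
    by apply: ler_wpM2l (ub r rT); exact: ltW.
  rewrite integZ//; apply: ler_wpM2l => //; exact: le_integ_itv.
have : `|traj x p t - x| <= x / 2.
  have [t0 tT'] := andP tT.
  rewrite -[X in _ - X](traj0 x p) traj_diff//.
  apply: (@le_trans _ _ (e * (x * E) * Q * T)); last first.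
    have -> : e * (x * E) * Q * T = e * (T * Q * E) * x by ring.
    have -> : x / 2 = 1 / 2 * x by ring.
    by apply: ler_wpM2r => //; exact: ltW.
  apply: (@le_trans _ _ (e * (x * E) * Q * (t - 0))).
    rewrite -integ_cst//; apply: le_normr_integ => //; first exact: L1loc_cst.
    by move=> r /andP[r0 rt]; apply: pb; rewrite r0 (le_trans rt).
  by rewrite subr0; apply: ler_wpM2l => //; exact: mulr_ge0.
rewrite ler_norml => /andP[h1 h2]; apply/andP; split; first by move: x0 h1; lra.
by move: x0 d0 xd h2; lra.
Qed.

(** [G] is bounded, so [|u - x|] is bounded independently of [x]. *)
Lemma large_data_stay_large q B : L1loc q ->
  exists2 x, (0 < x) && (B < x) & forall p, cauchy_solution G q x p ->
    forall t, 0 <= t <= T -> B < traj x p t.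
Proof.
move=> lq; have lq' := L1loc_norm lq.
have M0 : 0 <= M by apply: le_trans (G_bnd 0).
pose Q := integ (fun s => `|q s|) 0 T.
have Q0 : 0 <= Q by apply: integ_ge0.
have TMQ : 0 <= T * (M * Q) by rewrite !mulr_ge0.
have BB := ler_norm B; have B0 := normr_ge0 B.
exists (`|B| + T * (M * Q) + 1) => [|p Sp t tT].
  by apply/andP; split; lra.
set x := _ + 1 in Sp *; have lp := cauchy_solution_L1loc Sp; have [cp Ep] := Sp.
have pb s : 0 <= s <= T -> `|p s| <= M * Q.
  move=> /andP[s0 sT]; rewrite Ep normrN.
  apply: (@le_trans _ _ (integ (fun s => M * `|q s|) 0 s)).
    apply: le_normr_integ; [exact: (L1loc_force L_ge0 G_lip)|exact: L1locZ|].
    by move=> r _; rewrite normrM mulrC ler_wpM2r.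
  rewrite integZ//; apply: ler_wpM2l => //; exact: le_integ_itv.
have : `|traj x p t - x| <= T * (M * Q).
  have [t0 tT'] := andP tT.
  rewrite -[X in _ - X](traj0 x p) traj_diff//.
  apply: (@le_trans _ _ (M * Q * (t - 0))).
    rewrite -integ_cst//; apply: le_normr_integ => //; first exact: L1loc_cst.
    by move=> r /andP[r0 rt]; apply: pb; rewrite r0 (le_trans rt).
  by rewrite subr0 mulrC ler_wpM2r// mulr_ge0.
by rewrite ler_norml => /andP[h1 _]; move: h1 BB; rewrite /x; lra.
Qed.

(** For [e] small, [v(T)] is closer to [- int q] than to 0. *)
Lemma shooting_sign_mean q : L1loc q -> integ q 0 T != 0 ->
  exists2 e, 0 < e & forall x p, cauchy_solution G q x p ->
    (forall t, 0 <= t <= T -> 0 < traj x p t) ->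
    (forall s t z, 0 <= s <= T -> 0 <= t <= T -> traj x p s <= z -> z <= traj x p t ->
      `|G' z| <= e) ->
    p T * integ q 0 T < 0.
Proof.
move=> lq q0; pose Q := integ (fun s => `|q s|) 0 T; pose I := integ q 0 T.
have Q0 : 0 <= Q by apply: integ_ge0.
have I0 : 0 < `|I| by rewrite normr_gt0.
have TQ0 : 0 <= T * Q by rewrite mulr_ge0.
have TQ2 : 0 <= T * (2 * Q) ^+ 2 by rewrite mulr_ge0// sqr_ge0.
pose e1 := (2 * (T * Q + 1))^-1; pose e2 := `|I| / (2 * (T * (2 * Q) ^+ 2 + 1)).
have e10 : 0 < e1 by rewrite invr_gt0 mulr_gt0// ltr_wpDl.
have e20 : 0 < e2 by rewrite divr_gt0// mulr_gt0// ltr_wpDl.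
pose e := Num.min e1 e2; have e0 : 0 < e by rewrite lt_min e10.
have h1 : e * (T * Q) <= 1 / 2.
  apply: (@le_trans _ _ (e1 * (T * Q))); first by apply: ler_wpM2r => //; rewrite ge_min lexx.
  by rewrite mulrC ler_pdivrMr; [lra|rewrite mulr_gt0// ltr_wpDl].
have h2 : e * T * (2 * Q) ^+ 2 < `|I|.
  apply: (@le_lt_trans _ _ (e2 * (T * (2 * Q) ^+ 2))).
    by rewrite -mulrA; apply: ler_wpM2r => //; rewrite ge_min lexx orbT.
  rewrite /e2 mulrAC ltr_pdivrMr; last by rewrite mulr_gt0// ltr_wpDl.
  rewrite ltr_pM2l//; move: TQ2; move: (T * _) => z; lra.
exists e => // x p Sp u0 He.
have := le_lt_trans (shooting_estimate lq Sp u0 (ltW e0) He h1) h2.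
have TT : 0 <= T <= T by rewrite T_ge0 lexx.
have GT0 := G_pos (u0 T TT).
rewrite -/I; set v := p T / _ => vI.
have -> : p T * I = v * I * G (traj x p T) by rewrite /v; field; rewrite gt_eqF.
rewrite pmulr_llt0//.
have [Ip|In|E] := ltgtP I 0; last by rewrite E normr0 ltxx in I0.
  move: vI; rewrite (ltr0_norm Ip) ltr_norml => /andP[h _].
  by rewrite nmulr_llt0//; lra.
move: vI; rewrite (gtr0_norm In) ltr_norml => /andP[_ h].
by rewrite pmulr_llt0//; lra.
Qed.

Lemma shooting_small_mean q X : L1loc q -> integ q 0 T != 0 -> 0 < X ->
  exists2 x, 0 < x < X & forall p, cauchy_solution G q x p -> p T * integ q 0 T < 0.
Proof.
move=> lq q0 X0; have [e e0 He] := shooting_sign_mean lq q0.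
have [d d0 Hd] := G'_small0 e0.
have dX : 0 < Num.min d X by rewrite lt_min d0.
have [x xd Hx] := small_data_stay_small lq dX.
exists x => [|p Sp]; first by move: xd; rewrite lt_min => /andP[-> /andP[]].
apply: (He x p Sp) => [t tT|s t z sT tT sz zt]; first by have /andP[] := Hx p Sp t tT.
apply: Hd; have /andP[h1 _] := Hx p Sp s sT; have /andP[_] := Hx p Sp t tT.
by rewrite lt_min => /andP[h2 _]; rewrite (lt_le_trans h1 sz) (le_lt_trans zt h2).
Qed.

Lemma shooting_large_mean q X : L1loc q -> integ q 0 T != 0 ->
  exists2 x, (0 < x) && (X < x) & forall p, cauchy_solution G q x p -> p T * integ q 0 T < 0.
Proof.
move=> lq q0; have [e e0 He] := shooting_sign_mean lq q0.
have [B B0 HB] := G'_smalloo e0.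
have [x xB Hx] := large_data_stay_large (Num.max B X) lq.
exists x => [|p Sp]; first by move: xB; rewrite gt_max => /andP[-> /andP[]].
have uB t : 0 <= t <= T -> B < traj x p t.
  by move=> tT; have := Hx p Sp t tT; rewrite gt_max => /andP[].
apply: (He x p Sp) => [t tT|s t z sT tT sz zt]; first exact: lt_trans B0 (uB t tT).
by apply: HB; exact: lt_le_trans (uB s sT) sz.
Qed.

Lemma shooting_continuous (q : R -> R) (P : R -> R -> R) : L1loc q ->
  (forall x, cauchy_solution G q x (P x)) -> continuous (fun x => P x T).
Proof.
move=> lq SP.
pose Q := integ (fun s => `|q s|) 0 T.
have Q0 : 0 <= Q by apply: integ_ge0.
have := @lipschitz_continuous _ (fun x => P x T) (L * Q * expR (T * L * Q)).
apply; first by rewrite !mulr_ge0// expR_ge0.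
move=> x y.
have [_] := cauchy_solution_dependence L_ge0 G_lip G_bnd T_ge0 lq lq (SP x) (SP y).
rewrite (@eq_integ _ _ (fun=> 0) 0 T); last by move=> r _; rewrite subrr normr0.
rewrite integ_cst// mul0r !mulr0 add0r addr0 => H.
by rewrite -mulrA [_ * `|_|]mulrC.
Qed.

Lemma shooting_lipschitz_weight (q b : R -> R) (P : R -> R -> R) (x : R) mu :
  L1loc q -> L1loc b ->
  (forall nu, cauchy_solution G (fun t => q t - nu * b t) x (P nu)) ->
  exists2 C, 0 <= C & forall nu, `|P nu T - P mu T| <= C * `|nu - mu|.
Proof.
move=> lq lb SP.
have lw nu : L1loc (fun t => q t - nu * b t) by apply: L1locB => //; exact: L1locZ.
have M0 : 0 <= M by apply: le_trans (G_bnd 0).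
pose Q := integ (fun s => `|q s - mu * b s|) 0 T.
have Q0 : 0 <= Q by apply: integ_ge0.
pose b1 := integ (fun s => `|b s|) 0 T.
have b10 : 0 <= b1 by apply: integ_ge0.
exists (M * b1 * (1 + L * Q * (T * expR (T * L * Q)))).
  by rewrite mulr_ge0 ?mulr_ge0// addr_ge0// !mulr_ge0// expR_ge0.
move=> nu.
have [_] := cauchy_solution_dependence L_ge0 G_lip G_bnd T_ge0 (lw nu) (lw mu) (SP nu) (SP mu).
rewrite (@eq_integ _ _ (fun s => `|nu - mu| * `|b s|) 0 T); last first.
  move=> s _; rewrite -normrM -normrN; congr (`|_|); ring.
rewrite integZ; last exact: L1loc_norm.
rewrite subrr normr0 add0r -/Q -/b1 => H; apply: le_trans H _.
by rewrite le_eqVlt; apply/orP; left; apply/eqP; ring.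
Qed.

Lemma root_between (F : R -> R) (x y : R) : continuous F -> x < y -> F x * F y < 0 ->
  exists2 z, x < z < y & F z = 0.
Proof.
move=> cF xy Fxy.
have [||z + Fz] := @IVT R F x y 0 (ltW xy).
- exact: continuous_subspaceT.
- rewrite ge_min le_max; move: Fxy.
  have [Fx|Fx|->] := ltgtP (F x) 0; last by rewrite mul0r ltxx.
    by rewrite nmulr_rlt0// => /ltW ->; rewrite orbT.
  by rewrite pmulr_rlt0// => /ltW ->.
rewrite in_itv/= !le_eqVlt => /andP[/predU1P[zx|xz] /predU1P[zy|zy]].
- by move: xy; rewrite zx zy ltxx.
- by move: Fxy; rewrite zx Fz mul0r ltxx.
- by move: Fxy; rewrite -zy Fz mulr0 ltxx.
- by exists z; rewrite ?xz.
Qed.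

Definition neumann_data q x := 0 < x /\ exists2 p, cauchy_solution G q x p & p T = 0.

Definition two_neumann_data q := exists x y, [/\ x < y, neumann_data q x & neumann_data q y].

Lemma two_neumann_data_of_signs q (P : R -> R -> R) (x0 x1 x2 : R) : L1loc q ->
  (forall x, cauchy_solution G q x (P x)) -> 0 < x0 -> x0 < x1 -> x1 < x2 ->
  P x0 T * P x1 T < 0 -> P x1 T * P x2 T < 0 -> two_neumann_data q.
Proof.
move=> lq SP x00 x01 x12 P01 P12.
have cP := shooting_continuous lq SP.
have [z1 /andP[h1 h2] E1] := root_between cP x01 P01.
have [z2 /andP[h3 h4] E2] := root_between cP x12 P12.
have z10 := lt_trans x00 h1; have z12 := lt_trans h2 h3.
exists z1, z2; split => //.
- by split=> //; exists (P z1).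
- by split; [exact: lt_trans z10 z12|exists (P z2)].
Qed.

(** * Weights that change sign once *)
Section Weights.
Context (alpha beta : R -> R) (tau : R).
Hypotheses (l_alpha : L1loc alpha) (l_beta : L1loc beta).
Hypotheses (alpha_ge0 : forall t, 0 <= alpha t) (beta_ge0 : forall t, 0 <= beta t).
Hypothesis tauT : 0 <= tau <= T.
Hypothesis alpha_right : forall t, tau < t -> alpha t = 0.
Hypothesis beta_left : forall t, t <= tau -> beta t = 0.

Definition indefinite_weight lambda mu t := lambda * alpha t - mu * beta t.

Lemma L1loc_indefinite_weight lambda mu : L1loc (indefinite_weight lambda mu).
Proof. by apply: L1locB; exact: L1locZ. Qed.

Lemma integ_indefinite_weight lambda mu a b : integ (indefinite_weight lambda mu) a b =
  lambda * integ alpha a b - mu * integ beta a b.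
Proof. by rewrite integB ?integZ//; exact: L1locZ. Qed.

Lemma integ_alpha_right t : tau <= t -> t <= T -> integ alpha 0 t = integ alpha 0 T.
Proof.
move=> taut tT; have /andP[tau0 _] := tauT.
rewrite [RHS](integ_chasles l_alpha (le_trans tau0 taut) tT).
rewrite (@eq_integ_interior _ alpha (fun=> 0) t T)//; [|exact: L1loc_cst|].
  by rewrite integ_cst// mul0r addr0.
by move=> s /andP[ts _]; apply: alpha_right; exact: le_lt_trans ts.
Qed.

(** The velocity is nonincreasing from 0 on [[0, tau]] and nondecreasing to 0 on
    [[tau, T]], so it is nonpositive and [u >= u(T) > 0]. *)
Lemma neumann_data_positive lambda mu x p : 0 <= lambda -> 0 <= mu -> 0 < x ->
  cauchy_solution G (indefinite_weight lambda mu) x p -> p T = 0 ->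
  forall t, 0 <= t <= T -> 0 < traj x p t.
Proof.
move=> lam0 mu0 x0 Sp pT t /andP[t0 tT]; have lp := cauchy_solution_L1loc Sp.
have lq := L1loc_indefinite_weight lambda mu.
have uT := cauchy_solution_end_pos L_ge0 G_lip G_npos lq T_ge0 x0 Sp pT.
have p_le0 s : 0 <= s <= T -> p s <= 0.
  move=> /andP[s0 sT]; have [stau|taus] := leP s tau.
    have [_ ->] := Sp; rewrite oppr_le0; apply: integ_ge0 => r /andP[r0 rs].
    rewrite /indefinite_weight beta_left ?(le_trans rs)// mulr0 subr0.
    by rewrite !mulr_ge0.
  have := cauchy_solution_diff L_ge0 G_lip lq Sp s0 sT; rewrite pT sub0r => /oppr_inj ->.
  rewrite -oppr_ge0 -integN; last exact: (L1loc_force L_ge0 G_lip).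
  apply: integ_ge0 => r /andP[sr _].
  rewrite /indefinite_weight alpha_right ?(lt_le_trans taus)// mulr0 sub0r mulNr opprK.
  by rewrite !mulr_ge0.
have : 0 <= - integ p t T.
  rewrite -integN//; apply: integ_ge0 => s /andP[ts sT].
  by rewrite oppr_ge0; apply: p_le0; rewrite sT (le_trans t0).
by rewrite -(traj_diff x lp t0 tT); move: uT; lra.
Qed.

(** While [u >= 0] on [[0, t2]], concavity keeps [u] above [(t2 - t1) / t2] on
    [[0, t1]], so the slope at [t1] is at most [- lambda m int_0^t1 alpha]; if
    [lambda] is large this slope makes [u(t2) < 0].  From then on [u] is affine
    and decreasing, and [beta], which acts only after [tau], has no influence. *)
Lemma shooting_hits_zero lambda mu (t1 t2 m : R) p : 0 < lambda ->
  0 <= t1 -> t1 < t2 -> t2 <= tau -> 0 < m ->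
  (forall z, (t2 - t1) / t2 <= z <= 1 -> m <= G z) ->
  1 < lambda * (m * (t2 - t1) * integ alpha 0 t1) ->
  cauchy_solution G (indefinite_weight lambda mu) 1 p -> p T < 0.
Proof.
move=> lam0 t10 t12 t2tau m0 Gm lamL Sp.
have /andP[tau0 tau_T] := tauT.
have t20 := le_lt_trans t10 t12; have t2T := le_trans t2tau tau_T.
have lp := cauchy_solution_L1loc Sp; have lq := L1loc_indefinite_weight lambda mu.
have lf := L1loc_force L_ge0 G_lip 1 lq lp.
have q0 r : r <= tau -> indefinite_weight lambda mu r = lambda * alpha r.
  by move=> rtau; rewrite /indefinite_weight beta_left// mulr0 subr0.
have p_ni s t : 0 <= s -> s <= t -> t <= t2 -> p t <= p s.
  move=> s0 st tt2; rewrite -subr_le0 (cauchy_solution_diff L_ge0 G_lip lq Sp s0 st) oppr_le0.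
  apply: integ_ge0 => r /andP[sr rt]; rewrite q0; last by rewrite (le_trans rt)// (le_trans tt2).
  by rewrite !mulr_ge0// ltW.
have p_le0 s : 0 <= s -> s <= t2 -> p s <= 0.
  by move=> s0 st2; rewrite -(cauchy_solution0 Sp); exact: p_ni.
have u_ub s t : 0 <= s -> s <= t -> t <= t2 -> traj 1 p t - traj 1 p s <= p s * (t - s).
  move=> s0 st tt2; rewrite traj_diff// -integ_cst//; apply: le_integ => //; first exact: L1loc_cst.
  by move=> r /andP[sr rt]; apply: p_ni => //; exact: le_trans tt2.
have u_lb s t : 0 <= s -> s <= t -> t <= t2 -> p t * (t - s) <= traj 1 p t - traj 1 p s.
  move=> s0 st tt2; rewrite traj_diff// -integ_cst//; apply: le_integ => //; first exact: L1loc_cst.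
  by move=> r /andP[sr rt]; apply: p_ni => //; exact: le_trans sr.
have u2 : traj 1 p t2 < 0.
  rewrite ltNge; apply/negP => u2.
  have u1 t : 0 <= t -> t <= t1 -> (t2 - t1) / t2 <= traj 1 p t <= 1.
    move=> t0 tt1; have tt2 := le_trans tt1 (ltW t12).
    apply/andP; split; last first.
      have := u_ub 0 t (lexx 0) t0 tt2; rewrite traj0 (cauchy_solution0 Sp) mul0r; lra.
    rewrite ler_pdivrMr//.
    have h1 := u_lb 0 t (lexx 0) t0 tt2; have h2 := u_ub t t2 t0 tt2 (lexx _).
    rewrite traj0 subr0 in h1.
    (* Concavity: the slope at [t] separates the chords on [0, t] and on [t, t2]. *)
    have h3 : (t2 - t) * (p t * t) <= (t2 - t) * (traj 1 p t - 1).
      by apply: ler_wpM2l => //; rewrite subr_ge0.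
    have h4 : t * (traj 1 p t2 - traj 1 p t) <= t * (p t * (t2 - t)) by exact: ler_wpM2l.
    have h5 : 0 <= t * traj 1 p t2 by exact: mulr_ge0.
    have E : traj 1 p t * t2 = (t2 - t) * (traj 1 p t - 1) - t * (traj 1 p t2 - traj 1 p t)
       + t * traj 1 p t2 + (t2 - t) by ring.
    have E' : (t2 - t) * (p t * t) = t * (p t * (t2 - t)) by ring.
    rewrite E; move: h3 h4 h5 tt1; rewrite E'.
    move: ((t2 - t) * (traj 1 p t - 1)) (t * (p t * (t2 - t))) => A B.
    move: (t * (traj 1 p t2 - traj 1 p t)) (t * traj 1 p t2) => C D; lra.
  have p1 : p t1 <= - (lambda * m * integ alpha 0 t1).
    have [_ ->] := Sp; rewrite lerN2 -integZ//; apply: le_integ => //; first exact: L1locZ.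
    move=> r /andP[r0 rt1]; rewrite q0; last by rewrite (le_trans rt1)// (le_trans (ltW t12)).
    by rewrite mulrAC; apply: ler_wpM2l; [rewrite mulr_ge0// ltW|apply: Gm; exact: u1].
  have h1 := u_ub t1 t2 t10 (ltW t12) (lexx _).
  have /andP[_ h2] := u1 t1 t10 (lexx _).
  have t120 : 0 <= t2 - t1 by rewrite subr_ge0 ltW.
  have h3 : p t1 * (t2 - t1) <= - (lambda * m * integ alpha 0 t1) * (t2 - t1) by exact: ler_wpM2r.
  have E : - (lambda * m * integ alpha 0 t1) * (t2 - t1) =
    - (lambda * (m * (t2 - t1) * integ alpha 0 t1)) by ring.
  by move: lamL h1 h2 h3 u2; rewrite E; lra.
have p2_le0 := p_le0 t2 (ltW t20) (lexx _).
rewrite (cauchy_solution_stuck L_ge0 G_lip G_npos lq (ltW t20) t2T Sp (ltW u2) p2_le0).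
rewrite lt_neqAle p2_le0 andbT; apply/eqP => p20.
have := u_lb 0 t2 (lexx 0) (ltW t20) (lexx _); rewrite p20 mul0r traj0; move: u2; lra.
Qed.

Hypothesis alpha_gt0 : 0 < integ alpha 0 T.
Hypothesis beta_gt0 : 0 < integ beta 0 T.

(** The value [mu_0(lambda)], at which the weight has mean zero. *)
Definition balance lambda := lambda * (integ alpha 0 T / integ beta 0 T).

Let mean_weight lambda mu : integ (indefinite_weight lambda mu) 0 T =
  (balance lambda - mu) * integ beta 0 T.
Proof. by rewrite integ_indefinite_weight /balance; field; rewrite gt_eqF. Qed.

Hypothesis G'_pos0 : exists2 r, 0 < r & forall u, 0 < u -> u < r -> 0 < G' u.
Hypothesis G'_negoo : exists2 rho, 0 < rho & forall u, rho < u -> G' u < 0.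

Lemma balanced_signs lambda : 0 < lambda -> exists x1 x2, [/\ 0 < x1, x1 < x2,
  forall p, cauchy_solution G (indefinite_weight lambda (balance lambda)) x1 p -> p T < 0 &
  forall p, cauchy_solution G (indefinite_weight lambda (balance lambda)) x2 p -> 0 < p T].
Proof.
move=> lam0; set q := indefinite_weight _ _.
have lq : L1loc q := L1loc_indefinite_weight _ _.
have q0 : integ q 0 T = 0 by rewrite mean_weight subrr mul0r.
have /andP[tau0 tau_T] := tauT.
have qtau : integ q 0 tau != 0.
  rewrite integ_indefinite_weight integ_alpha_right//.
  rewrite (@eq_integ _ beta (fun=> 0) 0 tau); last by move=> t /andP[_ /beta_left].
  by rewrite integ_cst// mul0r mulr0 subr0 mulf_neq0// gt_eqF.
have [r r0 Hr] := G'_pos0; have [rho rho0 Hrho] := G'_negoo.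
have [x1 /andP[x10 x1r] Hx1] := small_data_stay_small lq r0.
have [x2 /andP[x20]] := large_data_stay_large (Num.max rho x1) lq.
rewrite gt_max => /andP[rx2 x12] Hx2.
exists x1, x2; split=> // p Sp.
- rewrite -[p T]mul1r; apply: (shooting_sign_zero_mean lq Sp _ _ q0 tauT qtau) => t tT.
    by have /andP[] := Hx1 p Sp t tT.
  by rewrite mul1r; have /andP[h1 h2] := Hx1 p Sp t tT; exact: Hr.
- have uB t : 0 <= t <= T -> rho < traj x2 p t.
    by move=> tT; have := Hx2 p Sp t tT; rewrite gt_max => /andP[].
  rewrite -oppr_lt0 -mulN1r; apply: (shooting_sign_zero_mean lq Sp _ _ q0 tauT qtau) => t tT.
    exact: lt_trans rho0 (uB t tT).
  by rewrite mulN1r oppr_gt0; apply: Hrho; exact: uB.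
Qed.

Lemma balanced_neumann_data lambda : 0 < lambda ->
  exists x, neumann_data (indefinite_weight lambda (balance lambda)) x.
Proof.
move=> lam0; have [x1 [x2 [x10 x12 Hx1 Hx2]]] := balanced_signs lam0.
have lq := L1loc_indefinite_weight lambda (balance lambda).
have /choice[P SP] := fun x => cauchy_solution_exists L_ge0 G_lip x lq.
have [|z /andP[xz zx] Pz] := root_between (shooting_continuous lq SP) x12.
  by rewrite nmulr_rlt0 ?Hx1 ?Hx2.
by exists z; split; [exact: lt_trans xz|exists (P z)].
Qed.

(** A negative mean makes the shooting function positive near 0. *)
Lemma two_neumann_data_above lambda mu x1 x2 : balance lambda < mu -> 0 < x1 -> x1 < x2 ->
  (forall p, cauchy_solution G (indefinite_weight lambda mu) x1 p -> p T < 0) ->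
  (forall p, cauchy_solution G (indefinite_weight lambda mu) x2 p -> 0 < p T) ->
  two_neumann_data (indefinite_weight lambda mu).
Proof.
move=> lam_mu x10 x12 H1 H2; have lq := L1loc_indefinite_weight lambda mu.
have q0 : integ (indefinite_weight lambda mu) 0 T < 0.
  by rewrite mean_weight pmulr_llt0// subr_lt0.
have /choice[P SP] := fun x => cauchy_solution_exists L_ge0 G_lip x lq.
have [x0 /andP[x00 x01] Hx0] := shooting_small_mean lq (negbT (lt_eqF q0)) x10.
apply: (two_neumann_data_of_signs lq SP x00 x01 x12).
  by have := Hx0 _ (SP x0); rewrite nmulr_llt0// => h; rewrite pmulr_rlt0// H1.
by rewrite nmulr_rlt0 ?H1 ?H2.
Qed.

(** The shooting function is positive both near 0 and near [+oo], so one negative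
    value suffices, with no restriction on the size of [mu]. *)
Lemma two_neumann_data_above_hit lambda mu x1 : balance lambda < mu -> 0 < x1 ->
  (forall p, cauchy_solution G (indefinite_weight lambda mu) x1 p -> p T < 0) ->
  two_neumann_data (indefinite_weight lambda mu).
Proof.
move=> lam_mu x10 H1; have lq := L1loc_indefinite_weight lambda mu.
have q0 : integ (indefinite_weight lambda mu) 0 T < 0.
  by rewrite mean_weight pmulr_llt0// subr_lt0.
have [x2 /andP[x20 x12] Hx2] := shooting_large_mean x1 lq (negbT (lt_eqF q0)).
apply: (two_neumann_data_above lam_mu x10 x12 H1) => p /Hx2.
by rewrite nmulr_llt0.
Qed.

(** A positive mean makes the shooting function negative near [+oo]. *)
Lemma two_neumann_data_below lambda mu x1 x2 : mu < balance lambda -> 0 < x1 -> x1 < x2 ->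
  (forall p, cauchy_solution G (indefinite_weight lambda mu) x1 p -> p T < 0) ->
  (forall p, cauchy_solution G (indefinite_weight lambda mu) x2 p -> 0 < p T) ->
  two_neumann_data (indefinite_weight lambda mu).
Proof.
move=> lam_mu x10 x12 H1 H2; have lq := L1loc_indefinite_weight lambda mu.
have q0 : 0 < integ (indefinite_weight lambda mu) 0 T.
  by rewrite mean_weight pmulr_lgt0// subr_gt0.
have /choice[P SP] := fun x => cauchy_solution_exists L_ge0 G_lip x lq.
have [x3 /andP[_ x23] Hx3] := shooting_large_mean x2 lq (negbT (gt_eqF q0)).
apply: (two_neumann_data_of_signs lq SP x10 x12 x23).
  by rewrite nmulr_rlt0 ?H1 ?H2.
by have := Hx3 _ (SP x3); rewrite pmulr_llt0// => h; rewrite pmulr_rlt0// H2.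
Qed.

Lemma shooting_sign_persists lambda mu x sg :
  (forall p, cauchy_solution G (indefinite_weight lambda mu) x p -> 0 < sg * p T) ->
  exists2 d, 0 < d & forall nu, `|nu - mu| < d ->
    forall p, cauchy_solution G (indefinite_weight lambda nu) x p -> 0 < sg * p T.
Proof.
move=> H; have llq : L1loc (fun t => lambda * alpha t) by exact: L1locZ.
have /choice[P SP] := fun nu =>
  cauchy_solution_exists L_ge0 G_lip x (L1loc_indefinite_weight lambda nu).
have c0 : 0 < sg * P mu T by exact: H.
have uniq nu p : cauchy_solution G (indefinite_weight lambda nu) x p -> p T = P nu T.
  move=> Sp; have lw := L1loc_indefinite_weight lambda nu.
  have [_] := cauchy_solution_dependence L_ge0 G_lip G_bnd T_ge0 lw lw Sp (SP nu).
  rewrite (@eq_integ _ _ (fun=> 0) 0 T); last by move=> r _; rewrite subrr normr0.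
  rewrite integ_cst// mul0r !mulr0 add0r addr0 subrr normr0 mul0r mulr0.
  by rewrite normr_le0 subr_eq0 => /eqP.
have [C C0 HC] := shooting_lipschitz_weight mu llq l_beta SP.
have sC0 : 0 < `|sg| * C + 1 by rewrite ltr_wpDl// mulr_ge0.
exists (sg * P mu T / (`|sg| * C + 1)) => [|nu]; first exact: divr_gt0.
rewrite ltr_pdivlMr// => hd p /uniq ->.
have h : `|sg * P nu T - sg * P mu T| < sg * P mu T.
  rewrite -mulrBr normrM; apply: le_lt_trans hd.
  apply: (@le_trans _ _ (`|sg| * (C * `|nu - mu|))); first exact: ler_wpM2l.
  rewrite mulrA mulrC ler_wpM2l// lerDl//.
by move: h; rewrite ltr_norml => /andP[h _]; lra.
Qed.

Lemma two_neumann_data_near lambda : 0 < lambda -> exists2 d, 0 < d &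
  forall mu, `|mu - balance lambda| < d -> mu != balance lambda ->
    two_neumann_data (indefinite_weight lambda mu).
Proof.
move=> lam0; have [x1 [x2 [x10 x12 Hx1 Hx2]]] := balanced_signs lam0.
have [|d1 d10 H1] := @shooting_sign_persists lambda (balance lambda) x1 (-1).
  by move=> p /Hx1; rewrite mulN1r oppr_gt0.
have [|d2 d20 H2] := @shooting_sign_persists lambda (balance lambda) x2 1.
  by move=> p /Hx2; rewrite mul1r.
exists (Num.min d1 d2) => [|mu]; first by rewrite lt_min d10.
rewrite lt_min => /andP[h1 h2] ne.
have {}H1 p : cauchy_solution G (indefinite_weight lambda mu) x1 p -> p T < 0.
  by move=> /(H1 _ h1); rewrite mulN1r oppr_gt0.
have {}H2 p : cauchy_solution G (indefinite_weight lambda mu) x2 p -> 0 < p T.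
  by move=> /(H2 _ h2); rewrite mul1r.
have [lt|gt|E] := ltgtP mu (balance lambda); last by rewrite E eqxx in ne.
- exact: two_neumann_data_below lt x10 x12 H1 H2.
- exact: two_neumann_data_above gt x10 x12 H1 H2.
Qed.

End Weights.

(** The threshold is built from the primitive [A] of [alpha] alone: [t1] and [t2]
    are points at which one third and two thirds of the mass of [alpha] are
    reached, so that [t1 < t2 < tau] whatever the switching time [tau] is. *)
Lemma hitting_threshold (A : R -> R) : continuous A -> A 0 = 0 ->
  {homo A : s t / s <= t} -> 0 < A T ->
  exists2 lambda_star, 0 < lambda_star &
    forall alpha beta tau lambda mu p,
      L1loc alpha -> L1loc beta -> (forall t, 0 <= alpha t) -> 0 <= tau <= T ->
      (forall t, tau < t -> alpha t = 0) -> (forall t, t <= tau -> beta t = 0) ->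
      (forall t, 0 <= t <= T -> integ alpha 0 t = A t) -> lambda_star < lambda ->
      cauchy_solution G (indefinite_weight alpha beta lambda mu) 1 p -> p T < 0.
Proof.
move=> cA A0 A_nd AT.
have ivt v : 0 <= v <= A T -> exists2 t, 0 <= t <= T & A t = v.
  move=> vT; have [||t] := @IVT R A 0 T v T_ge0; first exact: continuous_subspaceT.
    by rewrite A0 min_l ?max_r// ltW.
  by rewrite in_itv/=; exists t.
have [|t1 /andP[t10 t1T] At1] := ivt (A T / 3); first by apply/andP; split; lra.
have [|t2 /andP[t20 t2T] At2] := ivt (A T * 2 / 3); first by apply/andP; split; lra.
have t12 : t1 < t2.
  by rewrite ltNge; apply/negP => /A_nd; rewrite At1 At2; lra.
have t2p := le_lt_trans t10 t12.
(* [G] is bounded below on [[d, 1]], where the solution from 1 lies up to time [t1]. *)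
pose d := (t2 - t1) / t2.
have d0 : 0 < d by rewrite divr_gt0// subr_gt0.
have d1 : d <= 1 by rewrite ler_pdivrMr//; lra.
have [z + Gmin] := EVT_min d1 (continuous_subspaceT G_cont).
rewrite in_itv/= => /andP[dz _].
have m0 : 0 < G z by apply: G_pos; exact: lt_le_trans dz.
pose c := G z * (t2 - t1) * A t1.
have c0 : 0 < c by rewrite mulr_gt0 ?mulr_gt0 ?subr_gt0// At1; lra.
exists c^-1 => [|alpha beta tau lambda mu p la lb a0 tauT ar bl EA lam]; first by rewrite invr_gt0.
have lam0 : 0 < lambda by apply: lt_trans lam; rewrite invr_gt0.
have /andP[tau0 tau_T] := tauT.
have t2tau : t2 <= tau.
  rewrite leNgt; apply/negP => /ltW taut2.
  have := integ_alpha_right la tauT ar taut2 t2T.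
  by rewrite !EA ?t20 ?T_ge0 ?lexx// At2; move: AT; lra.
apply: (@shooting_hits_zero alpha beta tau la lb a0 tauT bl lambda mu t1 t2 (G z)) => //.
rewrite EA ?t10// -/c; by move: lam; rewrite -[c^-1]mul1r ltr_pdivrMr.
Qed.

End Shooting.

(** * From integral equations to Caratheodory solutions *)
Section Bridge.
Context {R : realType}.
Notation mu := (@lebesgue_measure R).
Implicit Types (f a q w : R -> R) (T x : R).

Lemma L1loc_restrict f (D : set R) : measurable D ->
  mu.-integrable D (EFin \o f) -> L1loc (f \_ D).
Proof.
move=> mD fD c d; apply: (@integrableS _ _ _ mu setT) => //.
by rewrite -restrict_EFin -integrable_mkcond.
Qed.

Lemma patch_ge0 f (D : set R) t : (forall s, 0 <= f s) -> 0 <= (f \_ D) t.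
Proof. by move=> f0; rewrite patchE; case: ifP => // _; exact: lexx. Qed.

Lemma ae_eq_Rintegral (D : set R) f h : measurable D ->
  mu.-integrable D (EFin \o f) -> mu.-integrable D (EFin \o h) ->
  {ae mu, forall t, D t -> f t = h t} ->
  \int[mu]_(t in D) f t = \int[mu]_(t in D) h t.
Proof.
move=> mD fD hD fh; rewrite /Rintegral; congr fine; apply: ae_eq_integral => //.
- exact: measurable_int fD.
- exact: measurable_int hD.
- move: fh; apply: filterS; first exact: (ae_filter_ringOfSetsType mu).
  by move=> t fh Dt; rewrite /= fh.
Qed.

(** The differential equation holds almost everywhere by Lebesgue's
    differentiation theorem for the primitive of an integrable function. *)
Lemma positive_solution_of_cauchy T (g w q : R -> R) (L x : R) p :
  0 < T -> g 0 = 0 -> 0 <= L ->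
  (forall y z, `|gext g y - gext g z| <= L * `|y - z|) ->
  L1loc q -> {ae mu, forall t, 0 <= t <= T -> w t = q t} ->
  cauchy_solution (gext g) q x p -> p T = 0 ->
  (forall t, 0 <= t <= T -> 0 < traj x p t) ->
  positive_solution T w g (traj x p).
Proof.
move=> T0 g0 L0 Glip lq wq Sp pT u0; have lp := cauchy_solution_L1loc Sp.
have [cp Ep] := Sp.
split=> //; split; first by move=> t /u0/ltW.
pose f s := - (q s * gext g (traj x p s)).
have lf : L1loc f by apply: L1locN; exact: (L1loc_force L0 Glip).
have Ef t : p t = integ f 0 t by rewrite Ep integN//; exact: (L1loc_force L0 Glip).
exists p; split=> //.
- split; last exact: continuous_subspaceT.
  move=> t /=; rewrite in_itv/= => tT; have := integ_has_derivative_within cp tT.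
  move=> /has_derivative_within_epsP H; apply/has_derivative_within_epsP => e e0.
  have [d d0 Hd] := H e e0; exists d => // y Dy yt yd.
  by rewrite /traj opprD addrACA subrr add0r; exact: Hd.
- by have := integ_absolutely_continuous 0 T lf; rewrite (_ : integ f 0 = p)//; apply/funext.
- have lfT : L1loc (f \_ `[0, T]) by apply: L1loc_restrict => //; exact: lf.
  have locf : locally_integrable setT (f \_ `[0, T]).
    by apply: integrable_locally => //; exact: lf.
  (* The base point -1 lies strictly before [0, T], so that [t = 0] is covered. *)
  have := FTC1 (a := BLeft (-1)) (fun y => lfT (-1) y) locf.
  move: wq; apply: filterS2; first exact: (ae_filter_ringOfSetsType mu).
  move=> t wqt Ft tT.
  have t1 : ((-1)%:E < t%:E)%E.
    by rewrite lte_fin; case/andP: tT => t0 _; exact: lt_le_trans (ltrN10 R) t0.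
  have [dF EF] := Ft t1.
  have := derivable_has_derivative_within `[0, T] dF.
  rewrite EF patchE mem_set/= ?in_itv//= => /has_derivative_within_epsP H.
  exists (f t); last by rewrite wqt// /f gextE ?addNr//; apply/ltW/u0.
  apply/has_derivative_within_epsP => e e0; have [d d0 Hd] := H e e0.
  exists d => // y Dy yt yd; have := Hd y Dy yt yd.
  have pF s : 0 <= s <= T -> p s = \int[mu]_(r in `[-1, s]) (f \_ `[0, T]) r.
    move=> /andP[s0 sT]; rewrite Ef -[RHS]/(integ (f \_ `[0, T]) (-1) s).
    rewrite (integ_chasles lfT (lerN10 R) s0) (@eq_integ_interior _ (f \_ `[0, T]) (fun=> 0) (-1) 0)//.
    - rewrite integ_cst ?lerN10// mul0r add0r; apply: eq_integ => r /andP[r0 rs].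
      by rewrite patchE mem_set//= in_itv/= r0 (le_trans rs).
    - exact: L1loc_cst.
    - move=> r /andP[_ r0]; rewrite patchE memNset//= in_itv/=.
      by rewrite leNgt r0.
  by rewrite !pF//; move: Dy; rewrite /= in_itv.
- exact: cauchy_solution0 Sp.
Qed.

(** Representatives of [a^+] and [a^-] that are nonnegative and supported in
    [[0, tau]] and [[tau, T]] at every point, not only almost everywhere. *)
Lemma split_weight T a (tau : R) : 0 <= tau <= T ->
  mu.-integrable `[0, T] (EFin \o a) ->
  {ae mu, forall t : R, 0 <= t <= tau -> 0 <= a t} ->
  {ae mu, forall t : R, tau <= t <= T -> a t <= 0} ->
  exists alpha beta : R -> R,
    [/\ L1loc alpha /\ L1loc beta,
        (forall t, 0 <= alpha t) /\ (forall t, 0 <= beta t),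
        (forall t, tau < t -> alpha t = 0) /\ (forall t, t <= tau -> beta t = 0),
        {ae mu, forall t, 0 <= t <= T -> a^\+ t = alpha t} &
        {ae mu, forall t, 0 <= t <= T -> a^\- t = beta t}].
Proof.
move=> /andP[tau0 tauT] ia aepos aeneg.
have ip : mu.-integrable `[0, T] (EFin \o a^\+) by exact: integrable_funrpos.
have im : mu.-integrable `[0, T] (EFin \o a^\-) by exact: integrable_funrneg.
exists (a^\+ \_ `[0, tau]), (a^\- \_ `]tau, T]); split.
- split; apply: L1loc_restrict => //.
    by apply: (@integrableS _ _ _ mu `[0, T]) => //; apply: subset_itvl; rewrite bnd_simp.
  by apply: (@integrableS _ _ _ mu `[0, T]) => //; apply: subset_itvr; rewrite bnd_simp.
- by split=> t; apply: patch_ge0 => s; [exact: funrpos_ge0|exact: funrneg_ge0].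
- split=> t tt; rewrite patchE memNset//= in_itv/=.
    by rewrite (leNgt t) tt andbF.
  by rewrite ltNge tt.
- move: aeneg; apply: filterS; first exact: (ae_filter_ringOfSetsType mu).
  move=> t H /andP[t0 tT]; rewrite patchE; case: ifPn => //.
  rewrite notin_setE/= in_itv/= t0/= => /negP; rewrite -ltNge => taut.
  by rewrite /funrpos max_r// H// tT ltW.
- move: aepos; apply: filterS; first exact: (ae_filter_ringOfSetsType mu).
  move=> t H /andP[t0 tT]; rewrite patchE; case: ifPn => //.
  rewrite notin_setE/= in_itv/= tT andbT => /negP; rewrite -leNgt => ttau.
  by rewrite /funrneg max_r// oppr_le0 H// t0.
Qed.

Lemma ae_eq_integ T f h t : mu.-integrable `[0, T] (EFin \o f) -> L1loc h -> t <= T ->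
  {ae mu, forall s, 0 <= s <= T -> f s = h s} ->
  \int[mu]_(s in `[0, t]) f s = integ h 0 t.
Proof.
move=> fT lh tT fh; apply: ae_eq_Rintegral => //.
  by apply: (@integrableS _ _ _ mu `[0, T]) => //; apply: subset_itvl; rewrite bnd_simp.
move: fh; apply: filterS; first exact: (ae_filter_ringOfSetsType mu).
by move=> s fh; rewrite /= in_itv/= => /andP[s0 st]; apply: fh; rewrite s0 (le_trans st).
Qed.

End Bridge.

Theorem theorem1p1 (R : realType) (T : R) (T_gt0 : 0 < T)
    (g g' : R -> R) (g_C1 : C1_on `[0, +oo[ g g')
    (g_at0 : g 0 = 0) (g_gt0 : forall u : R, 0 < u -> 0 < g u)
    (g'_lt0 : exists2 rho : R, 0 < rho & forall u : R, rho < u -> g' u < 0)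
    (g'_cvgy : g' u @[u --> +oo] --> (0 : R))
    (g'_gt0 : exists2 r : R, 0 < r & forall u : R, 0 < u -> u < r -> 0 < g' u)
    (g'_cvg0 : g' u @[u --> 0^'+] --> (0 : R))
    (a_plus : R -> R) :
  (* lambda_star is chosen before a, knowing only g and the (a.e. class of the)
     positive part of a on [0, T] *)
  exists2 lambda_star : R, 0 < lambda_star &
  forall a : R -> R,
    lebesgue_measure.-integrable `[0, T] (EFin \o a) ->
    {ae lebesgue_measure, forall t : R, 0 <= t <= T -> a^\+ t = a_plus t} ->
    0 < \int[lebesgue_measure]_(t in `[0, T]) a^\+ t ->
    0 < \int[lebesgue_measure]_(t in `[0, T]) a^\- t ->
    (exists tau : R,
       [/\ 0 <= tau <= T,
           {ae lebesgue_measure, forall t : R, 0 <= t <= tau -> 0 <= a t} &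
           {ae lebesgue_measure, forall t : R, tau <= t <= T -> a t <= 0}]) ->
    exists (mu_minus : R -> R) (mu_plus : R -> \bar R),
      (forall lambda : R, 0 < lambda ->
         [/\ 0 < mu_minus lambda,
             mu_minus lambda < mu0 T a lambda,
             ((mu0 T a lambda)%:E < mu_plus lambda)%E,
             has_positive_solution T a g lambda (mu0 T a lambda) &
             forall mu : R,
               mu_minus lambda < mu -> (mu%:E < mu_plus lambda)%E ->
               mu != mu0 T a lambda ->
               has_two_positive_solutions T a g lambda mu]) /\
      (forall lambda : R, lambda_star < lambda -> mu_plus lambda = +oo%E).
Proof.
have [L L0 Glip] := gext_lipschitz g_C1 g_at0 g'_cvgy.
have [M GM] := gext_bounded g_C1 g_at0 g'_lt0 g_gt0.
have Gnp := gext_npos g_at0.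
have Gpos z : 0 < z -> 0 < gext g z by move=> z0; rewrite gextE ?g_gt0// ltW.
have Gder := gext_is_derive g_C1.
have Gcont := g'_continuous g_C1.
have Glipon := gext_lipschitz_on g_C1 g_at0.
have Gs0 := g'_small_near0 g'_cvg0.
have Gsoo := g'_small_nearoo g'_cvgy.
have T0 : 0 <= T by exact: ltW.

have [lambda_star ls0 Hls] : exists2 lambda_star : R, 0 < lambda_star &
    forall a, lebesgue_measure.-integrable `[0, T] (EFin \o a) ->
    {ae lebesgue_measure, forall t : R, 0 <= t <= T -> a^\+ t = a_plus t} ->
    0 < \int[lebesgue_measure]_(t in `[0, T]) a^\+ t ->
    forall (alpha beta : R -> R) (tau lambda mu : R) p, L1loc alpha -> L1loc beta ->
      (forall t, 0 <= alpha t) -> 0 <= tau <= T ->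
      (forall t, tau < t -> alpha t = 0) -> (forall t, t <= tau -> beta t = 0) ->
      {ae lebesgue_measure, forall t, 0 <= t <= T -> a^\+ t = alpha t} ->
      lambda_star < lambda ->
      cauchy_solution (gext g) (indefinite_weight alpha beta lambda mu) 1 p -> p T < 0.
  (* The threshold may use any weight [a0] with the prescribed positive part, since
     only the integrals of that part enter; if there is none, nothing is required. *)
  have [[a0 [ia0 ea0 pa0]]|no] := pselect (exists a0 : R -> R,
    [/\ lebesgue_measure.-integrable `[0, T] (EFin \o a0),
      {ae lebesgue_measure, forall t : R, 0 <= t <= T -> a0^\+ t = a_plus t} &
      0 < \int[lebesgue_measure]_(t in `[0, T]) a0^\+ t]); last first.
    by exists 1 => // a ia ea pa; exfalso; apply: no; exists a.
  have ip0 : lebesgue_measure.-integrable `[0, T] (EFin \o a0^\+) by exact: integrable_funrpos.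
  have lA : L1loc (a0^\+ \_ `[0, T]) by exact: L1loc_restrict.
  have A_ge0 t : 0 <= (a0^\+ \_ `[0, T]) t by apply: patch_ge0 => s; exact: funrpos_ge0.
  have A_gt0 : 0 < integ (a0^\+ \_ `[0, T]) 0 T.
    rewrite (_ : integ _ 0 T = \int[lebesgue_measure]_(t in `[0, T]) a0^\+ t)//.
    by apply: eq_Rintegral => t tT; rewrite patchE tT.
  have [|lambda_star ls0 H] := @hitting_threshold R (gext g) L T T_gt0 L0 Glip Gnp Gpos
    (integ (a0^\+ \_ `[0, T]) 0) (integ_continuous lA) (integ_id _ _) _ A_gt0.
    by move=> s t st; exact: le_integ_itv.
  exists lambda_star => // a ia ea pa alpha beta tau lambda mu p la lb ag0 tauT ar bl aa lam.
  apply: (H alpha beta tau lambda mu p la lb ag0 tauT ar bl _ lam) => t /andP[t0 tT].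
  apply: esym; apply: ae_eq_integ (lA 0 T) la tT _.
  move: ea ea0 aa; apply: filterS3; first exact: (ae_filter_ringOfSetsType lebesgue_measure).
  move=> s h1 h2 h3 sT; rewrite patchE mem_set/= ?in_itv//=.
  by rewrite h2// -h1// h3.
exists lambda_star => // a ia ea pa na [tau [tauT aepos aeneg]].
have [alpha [beta [[la lb] [ag0 bg0] [ar bl] aa bb]]] := split_weight tauT ia aepos aeneg.
have ip : lebesgue_measure.-integrable `[0, T] (EFin \o a^\+) by exact: integrable_funrpos.
have im : lebesgue_measure.-integrable `[0, T] (EFin \o a^\-) by exact: integrable_funrneg.
have Ia := ae_eq_integ ip la (lexx T) aa.
have Ib := ae_eq_integ im lb (lexx T) bb.
have mu0E lambda : mu0 T a lambda = balance T alpha beta lambda by rewrite /mu0 Ia Ib.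
have pa' := pa; rewrite Ia in pa; rewrite Ib in na.
have lq lambda mu := L1loc_indefinite_weight la lb lambda mu.
have weq lambda mu : {ae lebesgue_measure, forall t, 0 <= t <= T ->
    weight a lambda mu t = indefinite_weight alpha beta lambda mu t}.
  move: aa bb; apply: filterS2; first exact: (ae_filter_ringOfSetsType lebesgue_measure).
  by move=> t h1 h2 tT; rewrite /weight /indefinite_weight h1// h2.
have sol lambda mu x : 0 < lambda -> 0 < mu ->
    neumann_data (gext g) T (indefinite_weight alpha beta lambda mu) x ->
    exists2 u, positive_solution T (weight a lambda mu) g u & u 0 = x.
  move=> lam0 mu0 [x0 [p Sp pT]]; exists (traj x p); last exact: traj0.
  apply: (positive_solution_of_cauchy T_gt0 g_at0 L0 Glip (lq lambda mu)) => //.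
  exact: (neumann_data_positive T_gt0 L0 Glip Gnp Gpos la lb ag0 bg0 ar bl (ltW lam0) (ltW mu0) x0 Sp pT).
have sol2 lambda mu : 0 < lambda -> 0 < mu ->
    two_neumann_data (gext g) T (indefinite_weight alpha beta lambda mu) ->
    has_two_positive_solutions T a g lambda mu.
  move=> lam0 mu0 [x [y [xy /(sol _ _ _ lam0 mu0)[u Su u0] /(sol _ _ _ lam0 mu0)[v Sv v0]]]].
  exists u, v; split=> //; exists 0; first by rewrite lexx.
  by rewrite u0 v0 lt_eqF.
have bal0 lambda : 0 < lambda -> 0 < balance T alpha beta lambda.
  by move=> lam0; rewrite mulr_gt0// divr_gt0.
have /choice[mm Hmm] : forall lambda, exists mm : R * \bar R,
   (0 < lambda -> [/\ 0 < mm.1, mm.1 < mu0 T a lambda, ((mu0 T a lambda)%:E < mm.2)%E &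
       forall mu, mm.1 < mu -> (mu%:E < mm.2)%E -> mu != mu0 T a lambda ->
         has_two_positive_solutions T a g lambda mu]) /\
   (lambda_star < lambda -> mm.2 = +oo%E).
  move=> lambda; have [lam0|lam0] := leP lambda 0.
    by exists (0, +oo%E); split=> // lam0'; move: (lt_le_trans lam0' lam0); rewrite ltxx.
  have [d d0 Hd] := two_neumann_data_near T_gt0 L0 Glip GM Gnp Gpos Gder Gcont Glipon Gs0 Gsoo
    la lb tauT ar bl pa na g'_gt0 g'_lt0 lam0.
  rewrite !mu0E; set b := balance T alpha beta lambda in Hd *.
  have b0 : 0 < b by exact: bal0.
  (* [b / 2] only serves to keep [mu_minus] positive. *)
  pose mm1 := Num.max (b / 2) (b - d).
  have mm1b : mm1 < b by rewrite gt_max; apply/andP; split; lra.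
  have mm10 : 0 < mm1 by rewrite lt_max divr_gt0.
  have near mu : mm1 < mu -> mu < b + d -> mu != b -> has_two_positive_solutions T a g lambda mu.
    move=> m1 m2 m3; apply: sol2 => //; first exact: lt_trans m1.
    apply: Hd => //; rewrite ltr_norml; move: m1; rewrite gt_max => /andP[_ m1].
    by apply/andP; split; lra.
  have [lam|lam] := ltP lambda_star lambda.
    exists (mm1, +oo%E); split=> // _; split=> //=; first by rewrite ltry.
    move=> mu m1 _ m3; have [m2|m2] := ltP mu b.
      by apply: near => //; apply: lt_trans m2 _; rewrite ltrDl.
    have m2' : b < mu by rewrite lt_neqAle eq_sym m3.
    apply: sol2 => //; first exact: lt_trans m1.
    apply: (two_neumann_data_above_hit T_gt0 L0 Glip GM Gnp Gpos Gder Gcont Glipon Gs0 Gsoo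
      la lb na m2' ltr01) => p Sp.
    exact: (Hls a ia ea pa' alpha beta tau lambda mu p la lb ag0 tauT ar bl aa lam Sp).
  exists (mm1, (b + d)%:E); split=> [_|//].
  by split=> //=; rewrite lte_fin ltrDl.
exists (fun lambda => (mm lambda).1), (fun lambda => (mm lambda).2); split; last first.
  by move=> lambda; exact: (Hmm lambda).2.
move=> lambda lam0; have [h1 h2 h3 h4] := (Hmm lambda).1 lam0; split=> //.
have [x Hx] := balanced_neumann_data T_gt0 L0 Glip GM Gnp Gpos Gder Gcont Glipon Gs0
  la lb tauT ar bl pa na g'_gt0 g'_lt0 lam0.
rewrite mu0E; have [u Su _] := sol _ _ _ lam0 (bal0 _ lam0) Hx.
by exists u.
Qed.
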